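(* Let $\Gamma,\tilde\Gamma$ be groups with pairs of automorphisms $\alpha_0,\alpha_1\in\mathrm{Aut}(\Gamma)$ and $\tilde\alpha_0,\tilde\alpha_1\in\mathrm{Aut}(\tilde\Gamma)$, and let $G=L\Gamma\rtimes V$ and $\tilde G=L\tilde\Gamma\rtimes V$ be the fraction groups associated to $(\Gamma,\alpha_0,\alpha_1)$ and $(\tilde\Gamma,\tilde\alpha_0,\tilde\alpha_1)$ respectively. Let $\theta:G\to\tilde G$ be an isomorphism. Then there exist a group morphism $\zeta:G\to Z(\tilde G)$, a homeomorphism $\varphi\in N_{H(\mathfrak C)}(V)$, an isomorphism $\kappa^0:L\Gamma\to L\tilde\Gamma$ and a cocycle $c:V\to L\tilde\Gamma$, $v\mapsto c_v$, such that $$\theta(av)=\zeta(a)\cdot\kappa^0(a)\cdot c_v\cdot\mathrm{ad}_\varphi(v)\quad\text{for all }a\in L\Gamma,\ v\in V.$$ Moreover, the following hold: (1) $\kappa^0$ is spatial in the sense that $\mathrm{supp}(\kappa^0(a))=\varphi(\mathrm{supp}(a))$ for all $a\in L\Gamma$. (2) There exists a family of isomorphisms $(\kappa^0_x:x\in\mathfrak C)$ from $\Gamma$ to $\tilde\Gamma$ such that $\kappa^0(a)(\varphi(x))=\kappa^0_x(a(x))$ for all $a\in L\Gamma$, $x\in\mathfrak C$. (3) For all $x\in\mathfrak C$ and $v\in V$, $$\kappa^0_{vx}\circ\tau_{v,x}=\mathrm{ad}(c_v(\varphi(vx)))\circ\tilde\tau_{\mathrm{ad}_\varphi(v),\varp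hi(x)}\circ\kappa^0_x.$$
   Context: Let $\mathfrak C=\{0,1\}^{\mathbf N}$ be the Cantor space. A standard dyadic interval (sdi) is a set $I=\{m_I\cdot y: y\in\mathfrak C\}$ of all sequences with a given finite prefix $m_I$ (the word of $I$). A standard dyadic partition (sdp) is a finite partition of $\mathfrak C$ into sdi. Thompson's group $V$ is the group of homeomorphisms $v$ of $\mathfrak C$ for which there are two sdp $(I_k)_{k=1}^n$, $(J_k)_{k=1}^n$ with $v(m_{I_k}\cdot x)=m_{J_k}\cdot x$ for all $k$, $x$. An sdi $I$ is adapted to $v$ if there is a finite word $m$ with $v(m_I\cdot x)=m\cdot x$ for all $x\in\mathfrak C$; then $v(I)$ is the sdi with word $m$. $N_{H(\mathfrak C)}(V)=\{\varphi\in\mathrm{Homeo}(\mathfrak C):\varphi V\varphi^{-1}=V\}$ and $\mathrm{ad}_\varphi(v)=\varphi v\varphi^{-1}$. For a group $\Gamma$ with $\alpha_0,\alpha_1\in\mathrm{Aut}(\Gamma)$: for a finite word $m=l_1\cdots l_n$ put $\alpha_m=\alpha_{l_n}\circ\cdots\circ\alpha_{l_1}$, and $\alpha_I=\alpha_{m_I}$. $L\Gamma$ is the group (pointwise product) of locally constant maps $a:\mathfrak C\to\Gamma$ (constant on each piece of some sdp); $\mathrm{supp}(a)=\{x:a(x)\ne e_\Gamma\}$. For $v\in V$, $x\in\mathfrak C$ put $\tau_{v,x}=\alpha_{v(I)}^{-1}\circ\alpha_I$ for any sdi $I\ni x$ adapted to $v$ (independent of $I$). The Jones action is $\pi_v(a)(vx)=\tau_{v,x}(a(x))$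 and the fraction group associated to $(\Gamma,\alpha_0,\alpha_1)$ is $L\Gamma\rtimes V$ for this action ($vav^{-1}=\pi_v(a)$). $\tilde\tau$ and $\tilde\pi$ denote the analogous objects for $(\tilde\Gamma,\tilde\alpha_0,\tilde\alpha_1)$. $Z(\cdot)$ denotes the center of a group and $\mathrm{ad}(h):g\mapsto hgh^{-1}$. That $c:V\to L\tilde\Gamma$ is a cocycle means $c_{vw}=c_v\cdot\tilde\pi_{\mathrm{ad}_\varphi(v)}(c_w)$ for all $v,w\in V$, i.e. $v\mapsto c_v\cdot\mathrm{ad}_\varphi(v)\in\tilde G$ is multiplicative. *)

(* Defs.v *)
From HB Require Import structures.
From mathcomp Require Import all_boot.
From mathcomp Require Export monoid.
From mathcomp Require Import boolp classical_sets functions topology cantor.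

Set Implicit Arguments.
Unset Strict Implicit.
Unset Printing Implicit Defensive.

Local Open Scope classical_set_scope.
Local Open Scope group_scope.

Definition ad (G : groupType) (h g : G) : G := h * g * h^-1.

Definition center (G : groupType) : set G := [set z | forall g, commute z g].

Record group_iso (G H : groupType) := GroupIso {
  iso_fun :> G -> H;
  iso_inv : H -> G;
  iso_morph : {morph iso_fun : x y / x * y};
  iso_funK : cancel iso_fun iso_inv;
  iso_invK : cancel iso_inv iso_fun }.

HB.instance Definition _ (G H : groupType) (f : group_iso G H) :=
  isMultiplicative.Build G H f (@iso_morph G H f).

Section GroupIso.
Variables G H K : groupType.

Lemma group_isoP (f g : group_iso G H) : f =1 g -> f = g.
Proof.
case: f g => [f f' fM fK f'K] [g g' gM gK g'K] /= /funext efg.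
case: g / efg gM gK g'K => gM gK g'K.
have e : f' = g' by apply: funext => x; rewrite -{1}(g'K x) fK.
by case: g' / e gK g'K => gK g'K; congr GroupIso; exact: Prop_irrelevance.
Qed.

Definition iso_id : group_iso G G :=
  @GroupIso G G id id (fun _ _ => erefl) (fun _ => erefl) (fun _ => erefl).

Lemma iso_sym_morph (f : group_iso G H) : {morph iso_inv f : x y / x * y}.
Proof.
by move=> x y; rewrite -{1}(iso_invK f x) -{1}(iso_invK f y) -iso_morph iso_funK.
Qed.

Definition iso_sym (f : group_iso G H) : group_iso H G :=
  GroupIso (iso_sym_morph f) (@iso_invK _ _ f) (@iso_funK _ _ f).

Lemma iso_comp_morph (f : group_iso H K) (g : group_iso G H) :
  {morph f \o g : x y / x * y}.
Proof. by move=> x y /=; rewrite !iso_morph. Qed.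

Definition iso_comp (f : group_iso H K) (g : group_iso G H) : group_iso G K :=
  GroupIso (iso_comp_morph f g)
    (can_comp (@iso_funK _ _ f) (@iso_funK _ _ g))
    (can_comp (@iso_invK _ _ g) (@iso_invK _ _ f)).

End GroupIso.

Record homeo := Homeo {
  homeo_fun :> cantor_space -> cantor_space;
  homeo_inv : cantor_space -> cantor_space;
  homeo_funK : cancel homeo_fun homeo_inv;
  homeo_invK : cancel homeo_inv homeo_fun;
  homeo_fun_cts : continuous homeo_fun;
  homeo_inv_cts : continuous homeo_inv }.

HB.instance Definition _ := gen_eqMixin homeo.
HB.instance Definition _ := gen_choiceMixin homeo.

Lemma homeoP (f g : homeo) : f =1 g -> f = g.
Proof.
case: f g => [f f' fK f'K fc f'c] [g g' gK g'K gc g'c] /= /funext efg.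
case: g / efg gK g'K gc => gK g'K gc.
have e : f' = g' by apply: funext => x; rewrite -{1}(g'K x) fK.
case: g' / e gK g'K g'c => gK g'K g'c.
by congr Homeo; exact: Prop_irrelevance.
Qed.

Lemma homeo_id_cts : continuous (id : cantor_space -> cantor_space).
Proof. by move=> x; exact: cvg_id. Qed.

Definition homeo_one : homeo :=
  @Homeo id id (fun _ => erefl) (fun _ => erefl) homeo_id_cts homeo_id_cts.

Definition homeo_sym (f : homeo) : homeo :=
  Homeo (homeo_invK f) (homeo_funK f) (@homeo_inv_cts f) (@homeo_fun_cts f).

Definition homeo_comp (f g : homeo) : homeo :=
  @Homeo (f \o g) (homeo_inv g \o homeo_inv f)
    (can_comp (@homeo_funK f) (@homeo_funK g))
    (can_comp (@homeo_invK g) (@homeo_invK f))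
    (fun x => continuous_comp (@homeo_fun_cts g x) (@homeo_fun_cts f _))
    (fun x => continuous_comp (@homeo_inv_cts f x) (@homeo_inv_cts g _)).

Lemma homeo_compA : associative homeo_comp.
Proof. by move=> f g h; exact: homeoP. Qed.

Lemma homeo_comp1f : left_id homeo_one homeo_comp.
Proof. by move=> f; exact: homeoP. Qed.

Lemma homeo_compf1 : right_id homeo_one homeo_comp.
Proof. by move=> f; exact: homeoP. Qed.

Lemma homeo_compVf : left_inverse homeo_one homeo_sym homeo_comp.
Proof. by move=> f; apply: homeoP => x; exact: homeo_funK. Qed.

Lemma homeo_compfV : right_inverse homeo_one homeo_sym homeo_comp.
Proof. by move=> f; apply: homeoP => x; exact: homeo_invK. Qed.

HB.instance Definition _ := isGroup.Build homeo
  homeo_compA homeo_comp1f homeo_compf1 homeo_compVf homeo_compfV.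

(* The infinite sequence m . x. *)
Definition prepend (m : seq bool) (x : cantor_space) : cantor_space :=
  fun n => if n < size m then nth false m n else x (n - size m).

Definition sdi (m : seq bool) : set cantor_space := range (prepend m).

(* A standard dyadic partition is given by the words of its pieces; the pieces
   are nonempty, so disjointness forces the words to be distinct. *)
Definition is_sdp n (I : 'I_n -> seq bool) : Prop :=
  \bigcup_k sdi (I k) = setT /\ trivIset setT (fun k => sdi (I k)).

Definition thompson : set homeo := [set v | exists n (I J : 'I_n -> seq bool),
  [/\ is_sdp I, is_sdp J &
      forall k x, v (prepend (I k) x) = prepend (J k) x]].

(* The sdi with word m is adapted to v, and its image has word m'. *)
Definition adapted (v : homeo) (m m' : seq bool) : Prop :=
  forall x, v (prepend m x) = prepend m' x.

Section Words.

Lemma prepend_nil x : prepend [::] x = x.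
Proof. by apply: funext => n; rewrite /prepend ltn0 subn0. Qed.

Lemma prepend_cat p q x : prepend (p ++ q) x = prepend p (prepend q x).
Proof.
apply: funext => n; rewrite /prepend size_cat nth_cat.
case: (ltnP n (size p)) => np; first by rewrite ltn_addr.
by rewrite -ltn_subLR // subnDA.
Qed.

Lemma prepend_take n (x : cantor_space) :
  prepend (mkseq x n) (fun k => x (n + k)) = x.
Proof.
apply: funext => k; rewrite /prepend size_mkseq.
by case: ltnP => kn; [rewrite nth_mkseq | rewrite subnKC].
Qed.

Lemma mkseq_prepend m x n : n <= size m -> mkseq (prepend m x) n = take n m.
Proof.
move=> nm; apply: (@eq_from_nth _ false) => [|i].
  by rewrite size_mkseq size_takel.
rewrite size_mkseq => lin.
by rewrite nth_mkseq // /prepend (leq_trans lin nm) nth_take.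
Qed.

Lemma prepend_eq p q x y : size p <= size q -> prepend p x = prepend q y ->
  take (size p) q = p.
Proof.
by move=> pq e; rewrite -(mkseq_prepend y pq) -e mkseq_prepend // take_size.
Qed.

Lemma prepend_inj m : injective (prepend m).
Proof.
move=> x y e; apply: funext => n.
have := congr1 (fun z : cantor_space => z (size m + n)) e.
by rewrite /prepend ltnNge leq_addr /= addKn.
Qed.

Lemma prepend_word_inj p q : (forall x, prepend p x = prepend q x) -> p = q.
Proof.
wlog pq : p q / size p <= size q => [hw e|e].
  by case/orP: (leq_total (size p) (size q)) => h; [|symmetry]; exact: hw.
have ep := prepend_eq pq (e (fun=> false)).
move: pq; rewrite leq_eqVlt => /predU1P[epq|lpq].
  by rewrite -ep epq take_size.
have E b := congr1 (fun z : cantor_space => z (size p)) (e (fun=> b)).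
by move: (E true) (E false); rewrite /prepend ltnn lpq => <-.
Qed.

Lemma prepend_cmp p q x y : prepend p x = prepend q y ->
  (exists s, q = p ++ s) \/ (exists s, p = q ++ s).
Proof.
move=> e; case/orP: (leq_total (size p) (size q)) => h; [left|right].
  by exists (drop (size p) q); rewrite -{1}(prepend_eq h e) cat_take_drop.
exists (drop (size q) p).
by rewrite -{1}(prepend_eq h (esym e)) cat_take_drop.
Qed.

Lemma word_sdp N : exists n (I : 'I_n -> seq bool),
  is_sdp I /\ forall k, size (I k) = N.
Proof.
exists #|{: N.-tuple bool}|, (fun k => tval (enum_val k)); split; last first.
  by move=> k; rewrite size_tuple.
split.
  apply/seteqP; split=> // x _.
  have s : size (mkseq x N) == N by rewrite size_mkseq.
  exists (enum_rank (Tuple s)) => //; exists (fun k => x (N + k)) => //.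
  by rewrite enum_rankK /= prepend_take.
move=> i j _ _ [z [[x _ <-] [y _ e]]].
apply: enum_val_inj; apply: val_inj => /=.
have ss : size (enum_val j) = size (enum_val i) by rewrite !size_tuple.
by rewrite -(prepend_eq _ e) ss ?take_size.
Qed.

Lemma sdp_depth n (I : 'I_n -> seq bool) : is_sdp I ->
  exists N, forall m, N <= size m -> exists k s, m = I k ++ s.
Proof.
move=> [Ic _]; exists (\max_k size (I k)) => m Nm.
have : (\bigcup_k sdi (I k)) (prepend m (fun=> false)) by rewrite Ic.
case=> k _ [y _ e]; exists k.
have kN : size (I k) <= size m by apply: leq_trans Nm; exact: leq_bigmax.
exists (drop (size (I k)) m).
by rewrite -{1}(prepend_eq kN e) cat_take_drop.
Qed.

End Words.

Section ThompsonGroup.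

Lemma thompsonP (v : homeo) : thompson v <->
  exists N, forall m, N <= size m -> exists m', adapted v m m'.
Proof.
split=> [[n [I [J [Is _ vIJ]]]]|[N hN]].
  have [N hN] := sdp_depth Is; exists N => m /hN [k [s ->]].
  by exists (J k ++ s) => x; rewrite !prepend_cat vIJ.
have [n [I [Is sI]]] := word_sdp N.
have hJ k : exists m', adapted v (I k) m' by apply: hN; rewrite sI.
have [J JP] := choice hJ.
exists n, I, J; split=> //; case: Is => Ic It; split.
  apply/seteqP; split=> // x _.
  have : (\bigcup_k sdi (I k)) (homeo_inv v x) by rewrite Ic.
  case=> k _ [y _ e]; exists k => //; exists y => //.
  by rewrite -JP e homeo_invK.
move=> i j _ _ [z [[x _ <-] [y _]]]; rewrite -!JP => e.
apply: It => //; exists (prepend (I i) x); split; first by exists x.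
by exists y => //; exact: (can_inj (@homeo_funK v)).
Qed.

Lemma thompson_deep (v : homeo) M : thompson v ->
  exists N, forall m, N <= size m ->
    exists m', adapted v m m' /\ M <= size m'.
Proof.
move=> /thompsonP [N hN]; exists (N + M) => m Nm.
have [|m' hm'] := hN (take N m); first by rewrite size_takel ?(leq_trans _ Nm) ?leq_addr.
exists (m' ++ drop N m); split.
  by move=> x; rewrite -{1}(cat_take_drop N m) !prepend_cat hm'.
by rewrite size_cat size_drop (leq_trans _ (leq_addl _ _)) // leq_subRL // (leq_trans _ Nm) // leq_addr.
Qed.

Lemma thompson1 : thompson 1.
Proof. by apply/thompsonP; exists 0 => m _; exists m. Qed.

Lemma thompsonV_closed v : thompson v -> thompson v^-1.
Proof.
move=> [n [I [J [Is Js vIJ]]]]; exists n, J, I; split=> // k x.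
by rewrite -vIJ; exact: homeo_funK.
Qed.

Lemma thompsonM v w : thompson v -> thompson w -> thompson (v * w).
Proof.
move=> /thompsonP [M hM] /(thompson_deep M) [N hN].
apply/thompsonP; exists N => m /hN [m' [mm' /hM [m'' mm'']]].
by exists m'' => x; rewrite /= -mm'' -mm'.
Qed.

Definition thompson_pred : {pred homeo} := fun v => `[< thompson v >].

Lemma thompson_group_closed : group_closed thompson_pred.
Proof.
split; first exact/asboolP/thompson1.
move=> v w /asboolP vV /asboolP wV; apply/asboolP.
by apply: thompsonM => //; exact: thompsonV_closed.
Qed.

End ThompsonGroup.

Record thompsonV := ThompsonV {
  thompsonV_val :> homeo;
  _ : thompson_pred thompsonV_val }.

HB.instance Definition _ := [isSub for thompsonV_val].
HB.instance Definition _ := [Choice of thompsonV by <:].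
HB.instance Definition _ :=
  SubChoice_isSubGroup.Build homeo thompson_pred thompsonV thompson_group_closed.

Lemma thompsonV_thompson (v : thompsonV) : thompson v.
Proof. exact/asboolP/(valP v). Qed.

Record normV := NormV {
  normV_val :> homeo;
  normV_norm : [set ad normV_val v | v in thompson] = thompson }.

Lemma adV_subproof (phi : normV) (v : thompsonV) : thompson_pred (ad (phi : homeo) (v : homeo)).
Proof.
apply/asboolP; rewrite -(normV_norm phi).
by exists v => //; exact: thompsonV_thompson.
Qed.

Definition adV (phi : normV) (v : thompsonV) : thompsonV :=
  ThompsonV (adV_subproof phi v).

Lemma thompsonVM (v w : thompsonV) x : (v * w) x = v (w x).
Proof. by []. Qed.

Lemma thompsonVK (v : thompsonV) : cancel v (v^-1)%g.
Proof. exact: homeo_funK. Qed.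

Lemma thompsonVVK (v : thompsonV) : cancel (v^-1)%g v.
Proof. exact: homeo_invK. Qed.

Definition locally_constant (Gam : Type) (a : cantor_space -> Gam) : Prop :=
  exists n (I : 'I_n -> seq bool), is_sdp I /\
    forall k, exists g, forall x, sdi (I k) x -> a x = g.

Record locconst (Gam : Type) := LocConst {
  locconst_fun :> cantor_space -> Gam;
  locconst_prop : locally_constant locconst_fun }.

Section LocConst.
Variable Gam : groupType.
Local Notation L := (locconst Gam).
Implicit Types a b : L.

Lemma locally_constantP (T : Type) (a : cantor_space -> T) :
  locally_constant a <->
  exists N, forall m, N <= size m -> exists g, forall x, a (prepend m x) = g.
Proof.
split=> [[n [I [Is aI]]]|[N hN]].
  have [N hN] := sdp_depth Is; exists N => m /hN [k [s ->]].
  have [g hg] := aI k; exists g => x; apply: hg.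
  by rewrite prepend_cat; exists (prepend s x).
have [n [I [Is sI]]] := word_sdp N; exists n, I; split=> // k.
have [|g hg] := hN (I k); first by rewrite sI.
by exists g => x [y _ <-].
Qed.

Lemma locconstP a b : a =1 b -> a = b.
Proof.
case: a b => [a ap] [b bp] /= /funext eab; case: b / eab bp => bp.
by congr LocConst; exact: Prop_irrelevance.
Qed.

HB.instance Definition _ := gen_eqMixin L.
HB.instance Definition _ := gen_choiceMixin L.

Lemma locconst_one_prop : locally_constant (fun=> 1 : Gam).
Proof. by apply/locally_constantP; exists 0 => m _; exists 1. Qed.

Lemma locconst_inv_prop a : locally_constant (fun x => (a x)^-1).
Proof.
have [n [I [Is aI]]] := locconst_prop a; exists n, I; split=> // k.
by have [g hg] := aI k; exists g^-1 => x /hg ->.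
Qed.

Lemma locconst_mul_prop a b : locally_constant (fun x => a x * b x).
Proof.
apply/locally_constantP.
have /locally_constantP [M hM] := locconst_prop a.
have /locally_constantP [N hN] := locconst_prop b.
exists (maxn M N) => m; rewrite geq_max => /andP[/hM[g hg] /hN[h hh]].
by exists (g * h) => x; rewrite hg hh.
Qed.

Definition locconst_one : L := LocConst locconst_one_prop.
Definition locconst_inv a : L := LocConst (locconst_inv_prop a).
Definition locconst_mul a b : L := LocConst (locconst_mul_prop a b).

Lemma locconst_mulA : associative locconst_mul.
Proof. by move=> a b c; apply: locconstP => x; exact: mulgA. Qed.

Lemma locconst_mul1a : left_id locconst_one locconst_mul.
Proof. by move=> a; apply: locconstP => x; exact: mul1g. Qed.

Lemma locconst_mula1 : right_id locconst_one locconst_mul.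
Proof. by move=> a; apply: locconstP => x; exact: mulg1. Qed.

Lemma locconst_mulVa : left_inverse locconst_one locconst_inv locconst_mul.
Proof. by move=> a; apply: locconstP => x; exact: mulVg. Qed.

Lemma locconst_mulaV : right_inverse locconst_one locconst_inv locconst_mul.
Proof. by move=> a; apply: locconstP => x; exact: mulgV. Qed.

HB.instance Definition _ := isGroup.Build L
  locconst_mulA locconst_mul1a locconst_mula1 locconst_mulVa locconst_mulaV.

Definition supp a : set cantor_space := [set x | a x <> 1].

End LocConst.

Section JonesAction.
Variables (Gam : groupType) (alpha : bool -> group_iso Gam Gam).
Local Notation L := (locconst Gam).

(* alpha false and alpha true are alpha_0 and alpha_1; the first letter of the
   word acts first. *)
Definition alpha_word (m : seq bool) : group_iso Gam Gam :=
  foldl (fun f l => iso_comp (alpha l) f) (iso_id Gam) m.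

Lemma alpha_word_rcons m l g : alpha_word (rcons m l) g = alpha l (alpha_word m g).
Proof. by rewrite /alpha_word foldl_rcons. Qed.

Lemma alpha_word_cat m s g :
  alpha_word (m ++ s) g = alpha_word s (alpha_word m g).
Proof.
elim/last_ind: s g => [|s l IH] g; first by rewrite cats0.
by rewrite -rcons_cat !alpha_word_rcons IH.
Qed.

Lemma ex_adapted (v : thompsonV) (x : cantor_space) :
  exists p : seq bool * seq bool, sdi p.1 x /\ adapted v p.1 p.2.
Proof.
have /thompsonP[N hN] := thompsonV_thompson v.
have [|m' mm'] := hN (mkseq x N); first by rewrite size_mkseq.
exists (mkseq x N, m'); split=> //=.
by exists (fun k => x (N + k)) => //; exact: prepend_take.
Qed.

(* Built from a chosen adapted sdi containing x; see tauE for the independence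
   of the choice. *)
Definition tau (v : thompsonV) (x : cantor_space) : group_iso Gam Gam :=
  let p := sval (cid (ex_adapted v x)) in
  iso_comp (iso_sym (alpha_word p.2)) (alpha_word p.1).

Lemma adapted_cat (v : homeo) p p' s q :
  adapted v p p' -> adapted v (p ++ s) q -> q = p' ++ s.
Proof.
by move=> hp hq; apply: prepend_word_inj => x; rewrite -hq !prepend_cat hp.
Qed.

Lemma alpha_word_quot p q s g :
  iso_inv (alpha_word (q ++ s)) (alpha_word (p ++ s) g) =
  iso_inv (alpha_word q) (alpha_word p g).
Proof.
apply: (can_inj (@iso_funK _ _ (alpha_word (q ++ s)))).
by rewrite iso_invK !alpha_word_cat iso_invK.
Qed.

Lemma tauE (v : thompsonV) x m m' : sdi m x -> adapted v m m' ->
  tau v x = iso_comp (iso_sym (alpha_word m')) (alpha_word m).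
Proof.
rewrite /tau; case: cid => [[p p'] /= [[y _ ey] pp']] [z _ ez] mm'.
apply: group_isoP => g /=.
have [[s es]|[s es]] := prepend_cmp (etrans ey (esym ez)).
  by move: mm'; rewrite es => /(adapted_cat pp') ->; rewrite alpha_word_quot.
by move: pp'; rewrite es => /(adapted_cat mm') ->; rewrite alpha_word_quot.
Qed.

Lemma tau_mul (v w : thompsonV) x g : tau (v * w) x g = tau v (w x) (tau w x g).
Proof.
have /thompsonP[M hM] := thompsonV_thompson v.
have [N hN] := thompson_deep M (thompsonV_thompson w).
have [|m' [mm' /hM[m'' mm'']]] := hN (mkseq x N); first by rewrite size_mkseq.
have xm : sdi (mkseq x N) x.
  by exists (fun k => x (N + k)) => //; exact: prepend_take.
rewrite (tauE xm mm') (@tauE v (w x) m' m'') //; last first.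
  by case: xm => y _ <-; rewrite mm'; exists y.
rewrite (@tauE (v * w) x (mkseq x N) m'') //=; first by rewrite iso_invK.
by move=> y; rewrite thompsonVM mm' mm''.
Qed.

Lemma tau_one x g : tau 1 x g = g.
Proof.
rewrite (@tauE 1 x [::] [::]) //; exists x => //; exact: prepend_nil.
Qed.

Lemma jones_prop (v : thompsonV) (a : L) :
  locally_constant (fun y => tau v (v^-1 y) (a (v^-1 y))).
Proof.
apply/locally_constantP.
have /locally_constantP [M hM] := locconst_prop a.
have [N hN] := thompson_deep M (thompsonV_thompson v^-1).
exists N => m /hN [m' [mm' /hM [g hg]]].
exists (iso_comp (iso_sym (alpha_word m)) (alpha_word m') g) => x.
rewrite mm' hg (@tauE v _ m' m) //; first by exists x.
by move=> y; rewrite -mm' thompsonVVK.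
Qed.

Definition jones (v : thompsonV) (a : L) : L := LocConst (jones_prop v a).

Lemma jonesE v a x : jones v a (v x) = tau v x (a x).
Proof.
change (tau v (v^-1 (v x)) (a (v^-1 (v x))) = tau v x (a x)).
by rewrite thompsonVK.
Qed.

Lemma jones_morph v : {morph jones v : a b / a * b}.
Proof. by move=> a b; apply: locconstP => x; exact: iso_morph. Qed.

Lemma jones1 a : jones 1 a = a.
Proof.
apply: locconstP => x; rewrite -{1}[x]/((1 : thompsonV) x) jonesE.
exact: tau_one.
Qed.

Lemma jonesM v w a : jones (v * w) a = jones v (jones w a).
Proof.
apply: locconstP => x; rewrite -(thompsonVVK (v * w) x); set y := _ x.
by rewrite jonesE thompsonVM !jonesE tau_mul.
Qed.

Lemma jones_one v : jones v 1 = 1.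
Proof. by apply: (@mulgI _ (jones v 1)); rewrite -jones_morph !mulg1. Qed.

End JonesAction.

(* The element a . v of the semidirect product; alpha enters only in frac_mul. *)
Record fraction (Gam : groupType) (alpha : bool -> group_iso Gam Gam) :=
  Fraction { frac_loc : locconst Gam; frac_tho : thompsonV }.

Section FractionGroup.
Variables (Gam : groupType) (alpha : bool -> group_iso Gam Gam).
Local Notation G := (fraction alpha).

HB.instance Definition _ := gen_eqMixin G.
HB.instance Definition _ := gen_choiceMixin G.

Definition frac_one : G := Fraction alpha 1 1.
Definition frac_mul (g h : G) : G :=
  Fraction alpha (frac_loc g * jones alpha (frac_tho g) (frac_loc h))
                 (frac_tho g * frac_tho h).
Definition frac_inv (g : G) : G :=
  Fraction alpha (jones alpha (frac_tho g)^-1 (frac_loc g)^-1) (frac_tho g)^-1.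

Lemma frac_mulA : associative frac_mul.
Proof.
by move=> [a u] [b v] [c w]; rewrite /frac_mul /= jones_morph jonesM !mulgA.
Qed.

Lemma frac_mul1g : left_id frac_one frac_mul.
Proof. by move=> [a v]; rewrite /frac_mul /= jones1 !mul1g. Qed.

Lemma frac_mulg1 : right_id frac_one frac_mul.
Proof. by move=> [a v]; rewrite /frac_mul /= jones_one !mulg1. Qed.

Lemma frac_mulVg : left_inverse frac_one frac_inv frac_mul.
Proof.
by move=> [a v]; rewrite /frac_mul /= -jones_morph !mulVg jones_one.
Qed.

Lemma frac_mulgV : right_inverse frac_one frac_inv frac_mul.
Proof.
by move=> [a v]; rewrite /frac_mul /= -jonesM !mulgV jones1 mulgV.
Qed.

HB.instance Definition _ := isGroup.Build G
  frac_mulA frac_mul1g frac_mulg1 frac_mulVg frac_mulgV.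

Definition inL (a : locconst Gam) : G := Fraction alpha a 1.
Definition inV (v : thompsonV) : G := Fraction alpha 1 v.

Lemma inL_morph : {morph inL : a b / a * b}.
Proof.
by move=> a b; rewrite {2}/mul /= /frac_mul /= jones1 mulg1.
Qed.

Lemma inV_morph : {morph inV : v w / v * w}.
Proof.
by move=> v w; rewrite {2}/mul /= /frac_mul /= jones_one mulg1.
Qed.

HB.instance Definition _ := isMultiplicative.Build _ _ inL inL_morph.
HB.instance Definition _ := isMultiplicative.Build _ _ inV inV_morph.

Lemma frac_decomp (g : G) : g = inL (frac_loc g) * inV (frac_tho g).
Proof. by case: g => a v; rewrite /mul /= /frac_mul /= jones1 mulg1 mul1g. Qed.

Lemma ad_inV (v : thompsonV) (a : locconst Gam) :
  ad (inV v) (inL a) = inL (jones alpha v a).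
Proof.
rewrite /ad; apply: (@mulIg _ (inV v)); rewrite -mulgA mulVg mulg1.
by rewrite /mul /= /frac_mul /= jones1 !mulg1 !mul1g.
Qed.

End FractionGroup.

Definition is_cocycle (Gam : groupType) (alpha : bool -> group_iso Gam Gam)
    (phi : normV) (c : thompsonV -> locconst Gam) : Prop :=
  forall v w, c (v * w) = c v * jones alpha (adV phi v) (c w).

(* Main.v *)
(* A nontrivial normal subgroup of V cannot be a product of two commuting
   conjugate subgroups: two such subgroups, after conjugation, move a common
   point and contain elements acting near it like any two prescribed
   commutators. Hence theta maps L Gam, which is the product of its
   restrictions to the two halves of the Cantor space, onto L Gam', and induces
   kappa on L Gam and an automorphism of V. The latter is spatial by Rubin's
   argument: disjointness of supports is expressible with commutators when one
   of the two elements has order 5.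

   Let x be a point with a x = 1. Then kappa a is central at phi x, and this
   central value is unchanged when a is moved by V away from x. Moving each
   half of a away from x thus defines a V-invariant central map, zeta a, with
   zeta a (phi x) = kappa a (phi x) whenever a x = 1; dividing kappa by zeta
   leaves a spatial isomorphism, whose inverse comes from theta^-1. *)
Require Import Defs.
From HB Require Import structures.
From mathcomp Require Import all_boot monoid.
From mathcomp Require Import boolp classical_sets functions topology cantor.

Set Implicit Arguments.
Unset Strict Implicit.
Unset Printing Implicit Defensive.

Local Open Scope classical_set_scope.
Local Open Scope group_scope.

(** * Words and elements of V *)

Lemma morph1 (G H : groupType) (f : G -> H) : {morph f : x y / x * y} ->
  f 1 = 1.
Proof. by move=> fM; apply: (@mulgI _ (f 1)); rewrite -fM !mulg1. Qed.

HB.instance Definition _ (G H : groupType) (f : group_iso G H) :=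
  Multiplicative_isUMagmaMorphism.Build G H f (morph1 (@iso_morph G H f)).

Lemma sdi_mkseq (x : cantor_space) k y :
  sdi (mkseq x k) y <-> mkseq y k = mkseq x k.
Proof.
split=> [[z _ <-]|e].
  by rewrite mkseq_prepend ?size_mkseq // take_oversize ?size_mkseq.
by exists (fun n => y (k + n)) => //; rewrite -e prepend_take.
Qed.

Lemma mem_sdi_mkseq (x : cantor_space) k : sdi (mkseq x k) x.
Proof. exact/sdi_mkseq. Qed.

Lemma mem_sdi m x : sdi m (prepend m x).
Proof. by exists x. Qed.

Lemma sdi_size m x : sdi m x -> m = mkseq x (size m).
Proof. by move=> [z _ <-]; rewrite mkseq_prepend // take_size. Qed.

Lemma sdi_mkseq_le (x : cantor_space) k l y : k <= l ->
  sdi (mkseq x l) y -> sdi (mkseq x k) y.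
Proof.
move=> kl [z _ <-]; apply/sdi_mkseq.
by rewrite mkseq_prepend ?size_mkseq // -{2}(prepend_take l x) mkseq_prepend
  ?size_mkseq.
Qed.

Lemma sdi_le p q x y : size p <= size q -> sdi p x -> sdi q x -> sdi q y ->
  sdi p y.
Proof.
move=> pq /sdi_size ep /sdi_size eq; rewrite ep {1}eq => ?.
exact: sdi_mkseq_le pq _.
Qed.

Lemma sdi_separate (x y : cantor_space) : x <> y ->
  exists k, forall l, k <= l -> ~ sdi (mkseq x l) y.
Proof.
move=> xy; have [k kP] : exists k, x k <> y k.
  by apply: contra_notP xy => h; apply: funext => k; apply: contrapT => ?;
    apply: h; exists k.
exists k.+1 => l kl /(sdi_mkseq_le kl)/sdi_mkseq/(congr1 (fun s => nth false s
  k)).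
by rewrite !nth_mkseq // => /esym.
Qed.

Lemma sdi_separate_word m x : ~ sdi m x ->
  forall l, size m <= l -> forall z, sdi m z -> ~ sdi (mkseq x l) z.
Proof.
move=> mx l ml z mz xz; apply: mx; apply: (sdi_le (q := mkseq x l) _ mz xz).
  by rewrite size_mkseq.
exact: mem_sdi_mkseq.
Qed.

(* The word of an sdi close to x but avoiding it. *)
Definition sibling (x : cantor_space) k := rcons (mkseq x k) (~~ x k).

Lemma siblingP (x : cantor_space) k y : sdi (sibling x k) y ->
  sdi (mkseq x k) y /\ ~ sdi (mkseq x k.+1) y.
Proof.
move=> /sdi_size; rewrite size_rcons size_mkseq /sibling mkseqS => /rcons_inj
  [e1 e2].
split; first by apply/sdi_mkseq; rewrite e1.
by move=> /sdi_mkseq; rewrite !mkseqS => /rcons_inj [_]; rewrite -e2;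
  case: (x k).
Qed.

(** Compactness of the Cantor space in the form of König's lemma: if [Q] failed at the empty word,
    choosing a bad child each time would trace an infinite branch all of whose prefixes are bad. *)
Lemma fan (Q : seq bool -> Prop) :
  (forall m, Q (rcons m false) -> Q (rcons m true) -> Q m) ->
  (forall x : cantor_space, exists k, Q (mkseq x k)) -> Q [::].
Proof.
move=> Qm Qx; apply: contrapT => nQ.
have /choice[f fP] (m : seq bool) : exists b, ~ Q m -> ~ Q (rcons m b).
  have [q0|q0] := pselect (Q (rcons m false)); last by exists false.
  by exists true => nq q1; apply: nq; exact: Qm.
pose u n := iter n (fun m => rcons m (f m)) [::].
have ux n : mkseq (f \o u) n = u n.
  by elim: n => // n IH; rewrite mkseqS IH.
have [k] := Qx (f \o u); rewrite ux.
by elim: k => //= n IH; apply: fP.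
Qed.

(** Convergence of the filter of prefixes is checked coordinatewise in the product topology;
    conversely a prefix imposes finitely many conditions on discrete coordinates. *)
Lemma nbhs_sdi (x : cantor_space) (A : set cantor_space) :
  nbhs x A <-> exists k, sdi (mkseq x k) `<=` A.
Proof.
split=> [|[k kA]].
  have F : Filter (filter_from [set: nat] (fun k => sdi (mkseq x k))).
    apply: filter_from_filter; first by exists 0.
    move=> i j _ _; exists (i + j) => // y yij.
    by split; apply: sdi_mkseq_le yij; rewrite ?leq_addr ?leq_addl.
  suff H : filter_from [set: nat] (fun k => sdi (mkseq x k)) --> x.
    by move=> /H [k _]; exists k.
  apply/cvg_sup => n; apply/cvg_image.
    by rewrite eqEsubset; split=> // b _; exists (fun=> b).
  move=> B /= /nbhs_singleton Bx; exists [set z : cantor_space | B (z n)].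
    exists n.+1 => // y /sdi_mkseq /(congr1 (fun s => nth false s n)) /=.
    by rewrite !nth_mkseq // => ->.
  by rewrite eqEsubset; split=> [_ [z Bz <-]|b Bb] //; exists (fun=> b).
have F : Filter (nbhs x) := nbhs_filter x.
apply: filterS kA _; elim: k => [|k IH].
  by apply: filterS filterT => y _; exact/sdi_mkseq.
have : nbhs x [set y : cantor_space | y k = x k].
  by apply: (@proj_continuous nat (fun=> bool) k x [set x k]);
    exact: discrete_set1.
move: IH; apply: filterS2 => y /sdi_mkseq e1 e2.
by apply/sdi_mkseq; rewrite !mkseqS e1 e2.
Qed.

Lemma cantor_continuousP (f : cantor_space -> cantor_space) :
  continuous f <-> forall (x : cantor_space) n, exists k, forall y,
    sdi (mkseq x k) y -> sdi (mkseq (f x) n) (f y).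
Proof.
split=> [fc x n|fP x A /nbhs_sdi[n nA]].
  by apply/nbhs_sdi; apply: fc; apply/nbhs_sdi; exists n.
have [k kP] := fP x n.
by apply/nbhs_sdi; exists k => y /kP /nA.
Qed.

Lemma adapted_continuous (f : cantor_space -> cantor_space) N :
  (forall m, N <= size m -> exists m', forall x,
    f (prepend m x) = prepend m' x) ->
  continuous f.
Proof.
move=> fN; apply/cantor_continuousP => x n.
have [|m' fm] := fN (mkseq x N); first by rewrite size_mkseq.
exists (N + n) => y xy; apply/sdi_mkseq; apply: (@eq_from_nth _ false).
  by rewrite !size_mkseq.
rewrite size_mkseq => i lt_in; rewrite !nth_mkseq //.
have [z _ ez] : sdi (mkseq x N) y by apply: sdi_mkseq_le xy; exact: leq_addr.
rewrite -(prepend_take N x) -ez !fm /prepend; case: ifPn => // _.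
have lt : N + (i - size m') < N + n.
  by rewrite ltn_add2l (leq_ltn_trans (leq_subr _ _)).
have /(congr1 (fun s => nth false s (N + (i - size m')))) :=
  iffLR (sdi_mkseq _ _ _) xy.
rewrite !nth_mkseq // -ez /prepend size_mkseq ltnNge leq_addr /= addKn => -> //.
Qed.

(** * Elements of V permuting finitely many disjoint sdi *)

Section PermuteWords.
Variables (T : finType) (w : T -> seq bool).
Hypothesis w_disj : forall i j x, sdi (w i) x -> sdi (w j) x -> i = j.

Definition permute_words (f : T -> T) (x : cantor_space) : cantor_space :=
  match pselect (exists p : T * cantor_space, x = prepend (w p.1) p.2) with
  | left h => let p := sval (cid h) in prepend (w (f p.1)) p.2
  | right _ => x
  end.

Lemma permute_wordsE f i x : permute_words f (prepend (w i) x) = prepend (w (f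
  i)) x.
Proof.
rewrite /permute_words; case: pselect => [h|[]]; last by exists (i, x).
case: cid => -[j y] /= e.
have ij : i = j by apply: (w_disj (x := prepend (w i) x));
  [exact: mem_sdi | rewrite e; exact: mem_sdi].
by move: e; rewrite -ij => /prepend_inj ->.
Qed.

Lemma permute_words_out f x : (forall i, ~ sdi (w i) x) ->
  permute_words f x = x.
Proof.
move=> h; rewrite /permute_words; case: pselect => // -[[i y] /= e].
by case: (h i); rewrite e; exact: mem_sdi.
Qed.

Lemma permute_words_adapted f m : \max_i size (w i) <= size m ->
  exists m', forall x, permute_words f (prepend m x) = prepend m' x.
Proof.
move=> wm; have [[i [s e]]|h] := pselect (exists i s, m = w i ++ s).
  by exists (w (f i) ++ s) => x; rewrite e !prepend_cat permute_wordsE.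
exists m => x; rewrite permute_words_out // => i [y _ e].
have im : size (w i) <= size m by rewrite (leq_trans _ wm) // leq_bigmax.
apply: h; exists i, (drop (size (w i)) m).
by rewrite -{1}(prepend_eq im e) cat_take_drop.
Qed.

Lemma permute_wordsK f g : cancel f g ->
  cancel (permute_words f) (permute_words g).
Proof.
move=> fK x; have [[i [y _ <-]]|h] := pselect (exists i, sdi (w i) x).
  by rewrite !permute_wordsE fK.
have o i : ~ sdi (w i) x by move=> ?; apply: h; exists i.
by rewrite !permute_words_out.
Qed.

Section Vperm.
Variables (f g : T -> T) (fK : cancel f g) (gK : cancel g f).

Definition vperm_homeo : homeo :=
  Homeo (permute_wordsK fK) (permute_wordsK gK)
    (adapted_continuous (@permute_words_adapted f))
    (adapted_continuous (@permute_words_adapted g)).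

Lemma vperm_subproof : thompson_pred vperm_homeo.
Proof.
by apply/asboolP/thompsonP; exists (\max_i size (w i)) => m;
  exact: permute_words_adapted.
Qed.

Definition vperm : thompsonV := ThompsonV vperm_subproof.

Lemma vpermE i x : vperm (prepend (w i) x) = prepend (w (f i)) x.
Proof. exact: permute_wordsE. Qed.

Lemma vperm_out x : (forall i, ~ sdi (w i) x) -> vperm x = x.
Proof. exact: permute_words_out. Qed.

End Vperm.
End PermuteWords.

(** * Rubin's disjointness relation *)

Lemma ex_swap p q : (forall x, sdi p x -> ~ sdi q x) ->
  exists s : thompsonV,
  [/\ forall x, s (prepend p x) = prepend q x,
      forall x, s (prepend q x) = prepend p x &
      forall x, ~ sdi p x -> ~ sdi q x -> s x = x].
Proof.
move=> pq; pose w (b : bool) := if b then q else p.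
have wd i j x : sdi (w i) x -> sdi (w j) x -> i = j.
  by case: i j => [] [] // h1 h2; case: (pq x).
exists (vperm wd negbK negbK); split=> [x|x|x px qx].
- exact: (vpermE wd negbK negbK false).
- exact: (vpermE wd negbK negbK true).
- by apply: vperm_out; case.
Qed.

Lemma thompsonV_ext (v w : thompsonV) : v =1 w -> v = w.
Proof. by move=> e; apply: val_inj; exact: homeoP. Qed.

Lemma thompsonV_inj (v : thompsonV) : injective v.
Proof. exact: can_inj (thompsonVK v). Qed.

Lemma neq1_moves (v : thompsonV) : v <> 1 -> exists x, v x <> x.
Proof.
move=> v1; apply: contrapT => h; apply: v1; apply: thompsonV_ext => x.
by apply: contrapT => vx; apply: h; exists x.
Qed.

Definition supported (A : set cantor_space) (v : thompsonV) :=
  forall x, ~ A x -> v x = x.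

Lemma supportedV A v : supported A v -> supported A v^-1.
Proof. by move=> vA x /vA e; rewrite -{1}e thompsonVK. Qed.

Lemma supportedM A v w : supported A v -> supported A w -> supported A (v * w).
Proof. by move=> vA wA x Ax; rewrite thompsonVM wA // vA. Qed.

Lemma supportedJ A v (g : thompsonV) : supported A v ->
  supported (g @^-1` A) (v ^ g).
Proof.
by move=> vA x Ax; rewrite /conjg !thompsonVM (vA (g x)) // thompsonVK.
Qed.

Lemma supported_sub A B v : A `<=` B -> supported A v -> supported B v.
Proof. by move=> AB vA x Bx; apply: vA => /AB. Qed.

Lemma supportedR A v (w : thompsonV) : supported A v ->
  supported (A `|` w @^-1` A) [~ v, w].
Proof.
move=> vA; apply: supportedM.
  by apply: supported_sub (supportedV vA); exact: subsetUl.
by apply: supported_sub (supportedJ (g := w) vA); exact: subsetUr.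
Qed.

Lemma supported_stable A v x : supported A v -> A x -> A (v x).
Proof.
move=> vA Ax; apply: contrapT => h; have /thompsonV_inj e := vA _ h.
by apply: h; rewrite e.
Qed.

Lemma supported_commute A B v w : supported A v -> supported B w ->
  (forall x, A x -> ~ B x) -> commute v w.
Proof.
move=> vA wB AB; apply: thompsonV_ext => x; rewrite !thompsonVM.
have [Ax|Ax] := pselect (A x).
  by rewrite (wB x) ?(wB (v x)) //; apply: AB => //; exact: supported_stable Ax.
rewrite (vA x) //; have [Bx|Bx] := pselect (B x); last by rewrite wB // vA.
by rewrite vA // => /AB; apply; exact: supported_stable Bx.
Qed.

(** [[~ n, v]] is [(v ^ n)^-1 * v], whose first factor commutes with [w] and drops out. This
    realises commutators of local elements as iterated commutators with a prescribed [n]. *)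
Lemma commg_absorb (G : groupType) (n v w : G) :
  commute (v ^ n) w -> [~ [~ n, v], w] = [~ v, w].
Proof.
move=> h; have -> : [~ n, v] = (v ^ n)^-1 * v.
  by rewrite /commg /conjg !invgM invgK !mulgA.
move: (v ^ n) h => c h; have {}h : c * w^-1 * c^-1 = w^-1.
  by apply: (canLR (mulgK _)); exact: commuteV.
by rewrite /commg /conjg !invgM invgK -[in RHS]h !mulgA.
Qed.

Definition displaces u (v : thompsonV) := forall x, sdi u x -> ~ sdi u (v x).

(** The sdi of [mkseq x k] misses [v x]. A deep prefix of [x] is carried to a word of length at
    least [k], whose sdi contains [v x] and would therefore lie inside that of [mkseq x k] if the
    two met. *)
Lemma displaces_near (v : thompsonV) (x : cantor_space) : v x <> x ->
  exists k, forall l, k <= l -> displaces (mkseq x l) v.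
Proof.
move=> /nesym/sdi_separate[k kP].
have [N NP] := thompson_deep k (thompsonV_thompson v).
have [|m' [mm' km']] := NP (mkseq x (N + k));
  first by rewrite size_mkseq leq_addr.
exists (N + k) => l kl y xy vy; apply: (kP k) => //.
apply: (@sdi_le _ m' (v y)); first by rewrite size_mkseq.
- by apply: sdi_mkseq_le vy; rewrite (leq_trans _ kl) ?leq_addl.
- by have [z _ <-] := sdi_mkseq_le kl xy; rewrite mm'; exact: mem_sdi.
- by rewrite -(prepend_take (N + k) x) mm'; exact: mem_sdi.
Qed.

Lemma displaces_conj_commute u n v w : displaces u n ->
  supported (sdi u) v -> supported (sdi u) w -> commute (v ^ n) w.
Proof.
move=> un /(supportedJ (g := n)) vu wu.
by apply: supported_commute vu wu _ => x /= unx /un.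
Qed.

(** A test element for the sdi of [u]: it moves exactly the points of that sdi, and it has the order
    required by [rubin_disjoint_supp]. *)
Lemma ex_5cycle u : exists g : thompsonV,
  g ^+ 5 = 1 /\ forall x, g x <> x <-> sdi u x.
Proof.
(* The words 0, 10, 110, 1110, 1111: [take 4] cuts 11110 to 1111, so that the five sdi partition the
   whole space. *)
pose c (i : 'I_5) := take 4 (rcons (nseq i true) false).
pose w i := u ++ c i.
have wd i j x : sdi (w i) x -> sdi (w j) x -> i = j.
  move=> [y _ <-] [z _]; rewrite !prepend_cat => /prepend_inj.
  move=> /(congr1 (fun t : cantor_space => (t 0, t 1%N, t 2, t 3))).
  by case: i j => [[|[|[|[|[|?]]]]] ?] [[|[|[|[|[|?]]]]] ?] // => [_|_|_|_|_];
    exact: val_inj.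
have cover x : sdi u x -> exists i, sdi (w i) x.
  suff H z : exists i, sdi (c i) z.
    by move=> [z _ <-]; have [i [y _ <-]] := H z; exists i, y;
      rewrite ?prepend_cat.
  case z0 : (z 0); last first.
    by exists (@Ordinal 5 0 isT); rewrite -(prepend_take 1 z) /mkseq /= z0;
      exact: mem_sdi.
  case z1 : (z 1%N); last first.
    by exists (@Ordinal 5 1 isT); rewrite -(prepend_take 2 z) /mkseq /= z0 z1;
      exact: mem_sdi.
  case z2 : (z 2); last first.
    by exists (@Ordinal 5 2 isT);
      rewrite -(prepend_take 3 z) /mkseq /= z0 z1 z2; exact: mem_sdi.
  case z3 : (z 3); last first.
    by exists (@Ordinal 5 3 isT);
      rewrite -(prepend_take 4 z) /mkseq /= z0 z1 z2 z3; exact: mem_sdi.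
  by exists (@Ordinal 5 4 isT);
    rewrite -(prepend_take 4 z) /mkseq /= z0 z1 z2 z3; exact: mem_sdi.
pose g := vperm wd (@ordSK 5) (@ord_predK 5).
have gout x : ~ sdi u x -> g x = x.
  by move=> ux; apply: vperm_out => i [y _ e]; apply: ux;
    rewrite -e prepend_cat; exact: mem_sdi.
exists g; split=> [|x].
  apply: thompsonV_ext => x; have [/cover[i [y _ <-]]|ux] := pselect (sdi u x).
    rewrite !thompsonVM !vpermE; congr (prepend (w _) y); apply: val_inj.
    by case: i => [[|[|[|[|[|?]]]]] ?].
  by rewrite !thompsonVM !gout.
split=> [gx|/cover[i [y _ <-]]].
  by apply: contrapT => /gout.
rewrite vpermE => e; have : ordS i = i.
  by apply: (wd _ _ (prepend (w i) y)); [rewrite -e|]; exact: mem_sdi.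
by case: i {e} => [[|[|[|[|[|?]]]]] ?] // /(congr1 val).
Qed.

Lemma ex_noncommuting u : exists v w v' w' : thompsonV,
  [/\ supported (sdi u) v, supported (sdi u) w,
      supported (sdi u) v', supported (sdi u) w' &
      ~ commute [~ v, w] [~ v', w']].
Proof.
pose W (i : bool * bool) := u ++ [:: i.1; i.2].
have Wd i j x : sdi (W i) x -> sdi (W j) x -> i = j.
  move=> /sdi_size ei /sdi_size; rewrite !size_cat /= in ei *; rewrite -ei.
  by move=> /eqP; rewrite eqseq_cat // eqxx /= => /eqP;
    case: i j {ei} => [? ?] [? ?] /= [-> ->].
(* On the four quarters of [u], the maps [a], [b], [c] swap 00 with 01, 01 with 10, and 10 with 11.
   The commutators of [a], [b] and of [b], [c] are 3-cycles whose two composites differ at 00. *)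
pose a (i : bool * bool) := match i with
  | (false, b) => (false, ~~ b) | _ => i end.
pose b (i : bool * bool) := match i with
  | (false, true) => (true, false) | (true, false) => (false,
    true) | _ => i end.
pose c (i : bool * bool) := match i with
  | (true, b) => (true, ~~ b) | _ => i end.
have aK : cancel a a by case=> [] [] [].
have bK : cancel b b by case=> [] [] [].
have cK : cancel c c by case=> [] [] [].
have sup f (fK : cancel f f) : supported (sdi u) (vperm Wd fK fK).
  move=> x ux; apply: vperm_out => i [y _ e]; apply: ux.
  by rewrite -e prepend_cat; exact: mem_sdi.
have inv f (fK : cancel f f) : (vperm Wd fK fK)^-1 = vperm Wd fK fK.
  by apply: thompsonV_ext => x; apply: (canLR (thompsonVK _));
    rewrite [RHS](permute_wordsK Wd fK).
exists (vperm Wd aK aK), (vperm Wd bK bK), (vperm Wd bK bK), (vperm Wd cK cK).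
split=> // /(congr1 (fun v : thompsonV => v (prepend (W (false,
  false)) (fun=> false)))).
rewrite /commg /conjg !inv !thompsonVM !vpermE /= => e.
by have := Wd _ _ _ (mem_sdi _ _) (eq_ind _ _ (mem_sdi _ _) _ (esym e)).
Qed.

(** The power [g ^+ k] inserts [k] copies of [s] after [p], and at [k = n] nothing may be
    inserted. *)
Lemma torsion_adapted (g : thompsonV) n p s : 0 < n -> g ^+ n = 1 ->
  adapted g p (p ++ s) -> s = [::].
Proof.
move=> n0 gn gps; pose rep k := iter k (cat s) [::].
have gk k y : (g ^+ k) (prepend p y) = prepend p (prepend (rep k) y).
  elim: k => [|k IH]; first by rewrite prepend_nil.
  by rewrite expgS thompsonVM IH gps -!prepend_cat -catA.
have size_rep k : size (rep k) = (k * size s)%N.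
  by elim: k => //= k IH; rewrite size_cat IH mulSn.
have rep0 : rep n = [::].
  apply: prepend_word_inj => y; rewrite prepend_nil.
  by apply: (@prepend_inj p); rewrite -gk gn.
move: (size_rep n); rewrite rep0 => /esym/eqP.
by rewrite muln_eq0 eqn0Ngt n0 /= => /nilP.
Qed.

(** At a fixed point [x], the word of an adapted sdi and its image word are both prefixes of [x]. If
    they differed, [g] or its inverse would shrink an sdi properly into itself, which finite order
    forbids. *)
Lemma torsion_fix_near (g : thompsonV) n (x : cantor_space) : 0 < n ->
  g ^+ n = 1 -> g x = x ->
  exists k, forall y, sdi (mkseq x k) y -> g y = y.
Proof.
move=> n0 gn gx.
have /thompsonP[N hN] := thompsonV_thompson g.
have [|m' mm'] := hN (mkseq x N); first by rewrite size_mkseq.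
exists N => _ [z _ <-]; rewrite mm'.
move: gx; rewrite -{1 2}(prepend_take N x) mm' => /prepend_cmp[[s es]|[s es]].
  suff s0 : s = [::] by rewrite es s0 cats0.
  apply: (@torsion_adapted g^-1 n m'); rewrite ?expVgn ?gn ?invg1 // -es => y.
  by rewrite -mm' thompsonVK.
suff s0 : s = [::] by rewrite es s0 cats0.
by apply: (@torsion_adapted g n (mkseq x N)); rewrite // -es.
Qed.

(** Rubin's algebraic substitute for disjointness of supports; being expressed by products and
    commutators alone, it is preserved by isomorphisms. *)
Definition rubin_disjoint (G : groupType) (f g : G) :=
  forall h, ~ commute f h ->
  exists f1 f2, [/\ commute g f1, commute g f2,
    commute g [~ [~ h, f2], f1] & [~ [~ h, f2], f1] <> 1].

Lemma rubin_disjoint_iso (G H : groupType) (psi : group_iso G H) f g :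
  rubin_disjoint f g -> rubin_disjoint (psi f) (psi g).
Proof.
move=> fg h fh; have [|f1 [f2 [c1 c2 ck k1]]] := fg (iso_inv psi h).
  by move=> /(gmulf_commute psi) /=; rewrite iso_invK.
have e : [~ [~ h, psi f2], psi f1] = psi [~ [~ iso_inv psi h, f2], f1].
  by rewrite -{1}(iso_invK psi h) (gmulfR psi) /= (gmulfR psi).
exists (psi f1), (psi f2); rewrite e; split; try exact: (gmulf_commute psi).
by rewrite -(morph1 (@iso_morph _ _ psi)) => /(can_inj (@iso_funK _ _ psi)).
Qed.

Definition disjoint_supp (f g : thompsonV) := forall x, f x <> x -> g x = x.

(** A point moved by both [f] and [h] has a small sdi [u] displaced by both, on which [g] is the
    identity. For [f1] and [f2] supported in [u], absorption reduces the double commutator to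
    [[~ f2, f1]]. *)
Lemma disjoint_supp_rubin f g : disjoint_supp f g -> rubin_disjoint f g.
Proof.
move=> fg h fh.
have [x [fx hx]] : exists x, f x <> x /\ h x <> x.
  apply: contrapT => H; apply: fh; apply: thompsonV_ext => x.
  have {}H y : f y <> y -> h y = y by move=> fy; apply: contrapT => hy;
    apply: H; exists y.
  rewrite !thompsonVM; have [fx|fx] := pselect (f x = x).
    rewrite fx; apply: contrapT => /[dup] fhx /H /thompsonV_inj hx.
    by apply: fhx; rewrite hx.
  by rewrite (H x) // H // => /thompsonV_inj.
have [k1 fu] := displaces_near fx; have [k2 hu] := displaces_near hx.
have {}fu := fu (k1 + k2) (leq_addr _ _);
  have {}hu := hu (k1 + k2) (leq_addl _ _).
set u := mkseq x _ in fu hu.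
have gu : supported (~` sdi u) g.
  move=> y /contrapT uy; apply: fg => fy; apply: (fu y uy); by rewrite fy.
have cg v : supported (sdi u) v -> commute g v.
  by move=> vu; apply: supported_commute gu vu _.
have [v [w [v' [w' [hv hw hv' hw' ncom]]]]] := ex_noncommuting u.
have sR a b : supported (sdi u) a -> supported (sdi u) b ->
  supported (sdi u) [~ a, b].
  by move=> ? ?; do !apply: supportedM => //; exact: supportedV.
exists [~ v', w'], [~ v, w].
rewrite commg_absorb; last by apply: displaces_conj_commute hu _ _; exact: sR.
split; [apply: cg; exact: sR|apply: cg; exact: sR|apply: cg; apply: (sR);
  exact: sR|].
by move=> e; apply: ncom; apply/commgP; rewrite e.
Qed.

(** As 5 is prime, the group generated by [g] acts freely on the orbit of a moved point. *)
Lemma order5_free (g : thompsonV) x i : g ^+ 5 = 1 -> g x <> x -> 0 < i < 5 ->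
  (g ^+ i) x <> x.
Proof.
move=> g5 gx; have e5 y : g (g (g (g (g y)))) = y.
  by rewrite -[RHS]/((1 : thompsonV) y) -g5.
case: i => [|[|[|[|[|]]]]] // _ e; apply: gx.
- by have := e5 x; do 2!rewrite [g (g x)]e.
- by have := e5 (g x); do 2!rewrite [g (g (g x))]e.
- by have := e5 x; rewrite [g (g (g (g x)))]e.
Qed.

(* With h supported in a small u, the commutator k below is supported in four
   translates of u by elements commuting with g, while its support is a union of
   g-orbits of size 5: some translate of u meets its image under a nontrivial
   power of g. *)
Lemma rubin_disjoint_supp f g : g ^+ 5 = 1 -> rubin_disjoint f g ->
  disjoint_supp f g.
Proof.
move=> g5 fg x fx; apply: contrapT => gx.
have [kf kfP] := displaces_near fx.
have /choice[kg kgP] (i : 'I_5) : exists k, 0 < i -> forall l, k <= l ->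
  displaces (mkseq x l) (g ^+ i).
  case: (posnP i) => [->|i0]; first by exists 0.
  have [|k kP] := @displaces_near (g ^+ i) x; last by exists k.
  by apply: order5_free => //; rewrite i0 ltn_ord.
pose l := kf + \max_i kg i; pose u := mkseq x l.
have fu : displaces u f by apply: kfP; exact: leq_addr.
have gu (i : 'I_5) : 0 < i -> displaces u (g ^+ i).
  by move=> /kgP; apply; rewrite (leq_trans _ (leq_addl _ _)) // leq_bigmax.
have ux : sdi u x by exact: mem_sdi_mkseq.
have [h [h5 hu]] := ex_5cycle u.
have hs : supported (sdi u) h by move=> y uy; apply: contrapT => /hu.
have [|f1 [f2 [gf1 gf2 gk k1]]] := fg h.
  move=> /(congr1 (fun v : thompsonV => v x)); rewrite !thompsonVM (hs (f x));
    last exact: fu.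
  by move=> /thompsonV_inj; exact/hu.
set k := [~ _, _] in gk k1; have [y ky] := neq1_moves k1.
have ks : supported ((sdi u `|` f2 @^-1` sdi u) `|` f1 @^-1` (sdi u `|` f2
  @^-1` sdi u)) k.
  apply: supportedR; apply: supportedR; exact: hs.
pose e (c : bool * bool) : thompsonV :=
  (if c.1 then f2 else 1) * (if c.2 then f1 else 1).
have ge c : commute g (e c).
  by apply: commuteM; case: ifP => // _; exact: commute1.
have /choice[c cP] (i : 'I_5) : exists c, sdi u (e c ((g ^+ i) y)).
  have : k ((g ^+ i) y) <> (g ^+ i) y.
    rewrite -thompsonVM (commuteX i (commute_sym gk)) thompsonVM.
    by move=> /thompsonV_inj.
  move=> ki; apply: contrapT => nc; apply: ki; apply: ks.
  case=> [[]|[]] h'; apply: nc.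
  - by exists (false, false).
  - by exists (true, false).
  - by exists (false, true).
  - by exists (true, true).
have ninj : ~ injective c.
  by move=> /leq_card; rewrite card_ord card_prod card_bool.
apply: ninj => i j cij.
wlog ij : i j cij / i <= j.
  by move=> W; case/orP: (leq_total i j) => ?; [|symmetry]; exact: W.
apply: val_inj; apply/eqP; move: ij; rewrite leq_eqVlt => /orP[//|ij].
have ji5 : j - i < 5 by rewrite (leq_ltn_trans (leq_subr _ _)).
have := gu (Ordinal ji5); rewrite /= subn_gt0 => /(_ ij) /(_ _ (cP i)); case.
rewrite -thompsonVM -(commuteX _ (commute_sym (ge _))) thompsonVM.
by rewrite -[X in e _ X]thompsonVM -expgnDr subnK 1?ltnW // cij.
Qed.

(** * Automorphisms of V *)

Lemma iso_expg (G H : groupType) (psi : group_iso G H) g n : psi (g ^+ n) =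
  psi g ^+ n.
Proof. exact: (gmulfXn psi). Qed.

Lemma iso1 (G H : groupType) (psi : group_iso G H) : psi 1 = 1.
Proof. exact: morph1 (@iso_morph _ _ psi). Qed.

Lemma iso_inv_expg (G H : groupType) (psi : group_iso G H) h n :
  iso_inv psi (h ^+ n) = iso_inv psi h ^+ n.
Proof. exact: (iso_expg (iso_sym psi)). Qed.

Lemma iso_inv1 (G H : groupType) (psi : group_iso G H) : iso_inv psi 1 = 1.
Proof. exact: (iso1 (iso_sym psi)). Qed.

Lemma disjoint_supp_iso (psi : group_iso thompsonV thompsonV) (f g :
  thompsonV) : g ^+ 5 = 1 ->
  disjoint_supp f g -> disjoint_supp (psi f) (psi g).
Proof.
move=> g5 fg; apply: rubin_disjoint_supp; first by rewrite -iso_expg g5 iso1.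
by apply: rubin_disjoint_iso; exact: disjoint_supp_rubin.
Qed.

(** If [psi g] fixed [y], it would fix a whole sdi around [y], being torsion. A test element of that
    sdi is disjoint from [psi g]; pulled back, it is disjoint from [g], hence from [f]; pushed
    forward again, it shows that [psi f] fixes [y]. *)
Lemma supp_iso_mono (psi : group_iso thompsonV thompsonV) (f g : thompsonV) :
  f ^+ 5 = 1 -> g ^+ 5 = 1 -> (forall x, f x <> x -> g x <> x) ->
  forall y, psi f y <> y -> psi g y <> y.
Proof.
move=> f5 g5 fg y fy gy.
have [k kP] : exists k, forall z, sdi (mkseq y k) z -> psi g z = z.
  by apply: (@torsion_fix_near _ 5) => //; rewrite -iso_expg g5 iso1.
have [h [h5 hP]] := ex_5cycle (mkseq y k).
have e5 : iso_inv psi h ^+ 5 = 1.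
  by rewrite -iso_inv_expg h5 iso_inv1.
have gh : disjoint_supp g (iso_inv psi h).
  rewrite -[g](iso_funK psi);
    apply: (@disjoint_supp_iso (iso_sym psi) (psi g) h h5) => z gz.
  by apply: contrapT => /hP /kP.
apply: fy; rewrite -(iso_invK psi h) in hP.
have /disjoint_supp_iso fh : disjoint_supp (iso_inv psi h) f.
  by move=> z hz; apply: contrapT => /fg/gh.
by apply: (fh psi f5); apply/hP; exact: mem_sdi_mkseq.
Qed.

(** A point is determined by the elements with trivial fifth power that move it; this relation is
    the graph of the point map behind [psi]. *)
Definition corresponds (psi : group_iso thompsonV thompsonV) (x y :
  cantor_space) :=
  forall g : thompsonV, g ^+ 5 = 1 -> (g x <> x <-> psi g y <> y).

Lemma corresponds_sym psi x y : corresponds psi x y ->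
  corresponds (iso_sym psi) y x.
Proof.
move=> xy g g5; rewrite -{1}(iso_invK psi g) -xy //.
by rewrite -iso_inv_expg g5 iso_inv1.
Qed.

Lemma corresponds_uniq psi x y z : corresponds psi x y ->
  corresponds psi x z -> y = z.
Proof.
move=> xy xz; apply: contrapT => /sdi_separate[k /(_ k (leqnn k)) kz].
have [h [h5 hP]] := ex_5cycle (mkseq y k).
have e5 : iso_inv psi h ^+ 5 = 1 by rewrite -iso_inv_expg h5 iso_inv1.
apply: kz; apply/hP; rewrite -(iso_invK psi h) -(xz _ e5) (xy _ e5) iso_invK;
  apply/hP.
exact: mem_sdi_mkseq.
Qed.

(** Compactness: were no [y] suitable, every point would have an sdi on which the image of some test
    element moving [x] is trivial, and these would glue to an element moving [x] with trivial
    image. *)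
Lemma ex_corresponds psi x : exists y, corresponds psi x y.
Proof.
suff [y yP] : exists y, forall g : thompsonV, g ^+ 5 = 1 -> g x <> x ->
  psi g y <> y.
  (* For the converse implication, if [g] fixes [x], then a test element [h] of a small sdi around
     [x] is disjoint from [g], while [psi h] moves [y]. *)
  exists y => g g5; split; [exact: yP|move=> gy gx].
  have [k kP] := torsion_fix_near (ltn0Sn 4) g5 gx.
  have [h [h5 hP]] := ex_5cycle (mkseq x k).
  have hg : disjoint_supp h g by move=> z /hP/kP.
  apply: gy; apply: (disjoint_supp_iso g5 hg).
  by apply: yP => //; apply/hP; exact: mem_sdi_mkseq.
apply: contrapT => noy.
pose Q m := exists g : thompsonV, [/\ g ^+ 5 = 1, g x <> x & forall z,
  sdi m z -> psi g z = z].
suff [g [g5 gx g1]] : Q [::].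
  apply: gx; have -> : g = 1; last by [].
  apply: (can_inj (@iso_funK _ _ psi)); rewrite iso1; apply: thompsonV_ext => z.
  by apply: g1; exists z => //; exact: prepend_nil.
apply: fan => [m [f [f5 fx fm]] [g [g5 gx gm]]|y].
  (* Gluing: a test element [h] of an sdi displaced by both [f] and [g] has its support inside both
     of theirs, so monotonicity makes [psi h] trivial on either half of [m]. *)
  have [k1 fk] := displaces_near fx; have [k2 gk] := displaces_near gx.
  have [h [h5 hP]] := ex_5cycle (mkseq x (k1 + k2)).
  have mono g' : g' ^+ 5 = 1 -> displaces (mkseq x (k1 + k2)) g' ->
      forall z, psi g' z = z -> psi h z = z.
    move=> g'5 g'u z g'z; apply: contrapT => hz.
    apply: (@supp_iso_mono psi h g' h5 g'5 _ z hz g'z) => t /hP tu e.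
    by apply: (g'u t); rewrite ?e.
  exists h; split=> //; first by apply/hP; exact: mem_sdi_mkseq.
  move=> _ [z _ <-]; have [b [t ->]] : exists b t, z = prepend [:: b] t.
    by exists (z 0), (fun n => z (1 + n)); rewrite -[LHS](prepend_take 1 z).
  rewrite -prepend_cat cats1; case: b.
    by apply: (mono g) => //; [apply: gk; exact: leq_addl | apply: gm;
      exact: mem_sdi].
  by apply: (mono f) => //; [apply: fk; exact: leq_addr | apply: fm;
    exact: mem_sdi].
have [g [g5 gx gy]] : exists g : thompsonV, [/\ g ^+ 5 = 1,
  g x <> x & psi g y = y].
  apply: contrapT => H; apply: noy; exists y => g g5 gx gy; apply: H;
    by exists g.
have [|k kP] := @torsion_fix_near (psi g) 5 y isT _ gy;
  first by rewrite -iso_expg g5 iso1.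
by exists k, g.
Qed.

Lemma corresponds_continuous psi (f : cantor_space -> cantor_space) :
  (forall x, corresponds psi x (f x)) -> continuous f.
Proof.
move=> fP; apply/cantor_continuousP => x n.
have [h [h5 hP]] := ex_5cycle (mkseq (f x) n).
have e5 : iso_inv psi h ^+ 5 = 1 by rewrite -iso_inv_expg h5 iso_inv1.
have moves z : iso_inv psi h z <> z <-> sdi (mkseq (f x) n) (f z).
  by rewrite (fP z _ e5) iso_invK; exact: hP.
have [k /(_ k (leqnn k)) kP] :=
  displaces_near (iffRL (moves x) (mem_sdi_mkseq _ _)).
by exists k => y yk; apply/moves => e; apply: (kP y); rewrite ?e.
Qed.

(** The point maps of [psi] and of its inverse are mutually inverse by uniqueness. Conjugating the
    test elements by [v] shows that the map intertwines [v] with [psi v]. *)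
Theorem thompsonV_automorphism (psi : group_iso thompsonV thompsonV) :
  exists phi : normV, forall v, psi v = adV phi v.
Proof.
have /choice[f fP] := ex_corresponds psi.
have /choice[f' f'P] := ex_corresponds (iso_sym psi).
have fK : cancel f f'.
  by move=> x; apply: (corresponds_uniq (f'P (f x))); exact: corresponds_sym.
have f'K : cancel f' f.
  by move=> x; apply: (corresponds_uniq (fP (f' x)));
    exact: (corresponds_sym (f'P x)).
pose phi := Homeo fK f'K (corresponds_continuous fP) (corresponds_continuous
  f'P).
have equiv (v : thompsonV) x : f (v x) = psi v (f x).
  apply: (corresponds_uniq (fP (v x))) => g g5.
  have e5 : (g ^ v) ^+ 5 = 1 by rewrite -conjXg g5 conj1g.
  have := fP x _ e5; rewrite (gmulfJ psi) /= => H.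
  split=> [gv|gv] e.
    by apply: (iffLR H) => [/(congr1 v)|];
      [rewrite homeo_invK | rewrite e homeo_funK].
  by apply: (iffRL H) => [/(congr1 (psi v))|];
    [rewrite homeo_invK | rewrite e homeo_funK].
have adE (v : thompsonV) : ad phi (v : homeo) = psi v.
  by apply: homeoP => x; rewrite /ad /= equiv f'K.
have norm : [set ad phi v | v in thompson] = thompson.
  apply/seteqP; split=> [_ [v vV <-]|v vV].
    have vp : thompson_pred v by exact/asboolP.
    by rewrite (adE (ThompsonV vp)); exact: thompsonV_thompson.
  have vp : thompson_pred v by exact/asboolP.
  exists (iso_inv psi (ThompsonV vp)); first exact: thompsonV_thompson.
  by rewrite adE iso_invK.
by exists (NormV norm) => v; apply: val_inj; rewrite /= adE.
Qed.

(** * Locally constant maps and their invariance *)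

Lemma supported_commg_displaces u (n v : thompsonV) x : displaces u n ->
  supported (sdi u) v -> sdi u x -> [~ n, v] x = v x.
Proof.
move=> un vu ux; have -> : [~ n, v] = (v ^ n)^-1 * v.
  by rewrite /commg /conjg !invgM invgK !mulgA.
rewrite thompsonVM; apply: (supportedV (supportedJ (g := n) vu)) => /= h.
by apply: un h; exact: supported_stable ux.
Qed.

(* If x is moved by q a and by some q (b ^ e), then on a small u around x the
   commutators [~ q a, m] and [~ q (b ^ e), m'] act as m and m',
     for all m and m'
   supported in u. *)
Lemma commuting_normal_image (L : groupType) (q : L -> thompsonV)
    (qM : {morph q : a b / a * b}) (qN : forall a v, exists b,
      q b = q a ^ v) (a b : L) :
  (forall d d' e, commute [~ a, d] [~ b ^ e, d']) -> q a <> 1 -> q b = 1.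
Proof.
move=> abC qa; apply: contrapT => qb.
have q1 : q 1 = 1 := morph1 qM.
have qV c : q c^-1 = (q c)^-1.
  by apply: (@mulIg _ (q c)); rewrite -qM !mulVg.
have qJ c d : q (c ^ d) = q c ^ q d by rewrite /conjg !qM qV.
have qR c d : q [~ c, d] = [~ q c, q d] by rewrite /commg /conjg !qM !qV.
have NR c v : exists d, q d = [~ q c, v].
  by have [d qd] := qN c v; exists (c^-1 * d); rewrite qM qV qd.
have [e [x [ax bx]]] : exists e x, q a x <> x /\ q (b ^ e) x <> x.
  have [x1 x1P] := neq1_moves qa; have [x2 x2P] := neq1_moves qb.
  have [ax2|ax2] := pselect (q a x2 = x2); last by exists 1, x2; rewrite conjg1.
  set z := (q a)^-1 x1; have az : q a z = x1 by rewrite thompsonVVK.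
  have x1z : x1 <> z by move=> e; apply: x1P; rewrite {1}e.
  have x2z : x2 <> z by move=> e; apply: x1P; rewrite -az -e ax2.
  have x21 : x2 <> x1 by move=> e; apply: x1P; rewrite -e.
  have [k1 k1P] := sdi_separate x1z; have [k2 k2P] := sdi_separate x2z.
  have [k3 k3P] := sdi_separate x21; have [k4 k4P] := displaces_near x2P.
  pose k := k1 + k2 + (k3 + k4).
  have {k1P}k1P := k1P k (leq_trans (leq_addr _ _) (leq_addr _ _)).
  have {k2P}k2P := k2P k (leq_trans (leq_addl _ _) (leq_addr _ _)).
  have {k3P}k3P := k3P k (leq_trans (leq_addr _ _) (leq_addl _ _)).
  have {k4P}k4P := k4P k (leq_trans (leq_addl _ _) (leq_addl _ _)).
  (* [s] takes [x1] to a point [y] near [x2] and fixes [z]. With [q d] the conjugate of [(q a)^-1]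
     by [s^-1], the product [q (a * d)] sends [y] through [z] to [x1], so a conjugator in the image
     of [q] brings the two moved points together. *)
  have [|s [s12 s21 s0]] := @ex_swap (mkseq x1 k) (mkseq x2 k).
    move=> y /sdi_mkseq y1 /sdi_mkseq y2; apply: k3P; apply/sdi_mkseq.
    by rewrite -y1 y2.
  pose t n := x1 (k + n); pose y := prepend (mkseq x2 k) t.
  have sx1 : s x1 = y by rewrite -{1}(prepend_take k x1) s12.
  have [d qd] := qN a^-1 s^-1.
  have fy : q (a * d) y = x1.
    rewrite qM qd qV /conjg !thompsonVM invgK -{1}sx1 thompsonVK.
    by rewrite -[X in s X]/z s0 // az.
  exists (a * d)^-1, x1; split=> //; rewrite qJ /conjg !thompsonVM qV invgK.
  rewrite -{1}fy thompsonVK -[X in _ <> X]fy => /thompsonV_inj.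
  move=> e; apply: (k4P y); first exact: mem_sdi.
  by rewrite e; exact: mem_sdi.
have [k1 k1P] := displaces_near ax; have [k2 k2P] := displaces_near bx.
have {}k1P := k1P (k1 + k2) (leq_addr _ _);
  have {}k2P := k2P (k1 + k2) (leq_addl _ _).
set u := mkseq x _ in k1P k2P.
have [v [w [v' [w' [hv hw hv' hw' ncom]]]]] := ex_noncommuting u.
have sR (f g : thompsonV) : supported (sdi u) f -> supported (sdi u) g ->
  supported (sdi u) [~ f, g].
  by move=> ? ?; do !apply: supportedM => //; exact: supportedV.
have hm := sR _ _ hv hw; have hm' := sR _ _ hv' hw'.
(* The image of [q] is normal, so it contains [[~ [~ q a, f], g]], which absorption identifies with
   [[~ f, g]]. *)
have inN f g : supported (sdi u) f -> supported (sdi u) g ->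
  exists d, q d = [~ f, g].
  move=> fu gu; have [c qc] := NR a f; have [d qd] := NR c g.
  by exists d; rewrite qd qc commg_absorb //;
    exact: displaces_conj_commute k1P _ _.
have [d qd] := inN _ _ hv hw; have [d' qd'] := inN _ _ hv' hw'.
apply: ncom; apply: thompsonV_ext => y; rewrite thompsonVM [RHS]thompsonVM.
have [uy|uy] := pselect (sdi u y); last by rewrite (hm y) // (hm' y) // hm.
have := congr1 (fun g : thompsonV => g y) (congr1 q (abC d d' e)).
rewrite (qM [~ a, d]) (qM [~ b ^ e, d']) !qR qd qd' thompsonVM [RHS]thompsonVM.
have mu := supported_stable hm uy; have mu' := supported_stable hm' uy.
by rewrite !(supported_commg_displaces k1P hm) ?(supported_commg_displaces k2P
  hm').
Qed.

(** * Restriction of locally constant maps to an sdi *)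

Section Restriction.
Variable Gam : groupType.
Local Notation L := (locconst Gam).
Implicit Types a b : L.

Lemma locconst_near a (x : cantor_space) :
  exists k, forall y, sdi (mkseq x k) y -> a y = a x.
Proof.
have /locally_constantP[N hN] := locconst_prop a.
have [|g gP] := hN (mkseq x N); first by rewrite size_mkseq.
by exists N => _ [z _ <-]; rewrite gP -[in RHS](prepend_take N x) gP.
Qed.

Lemma locally_constant_near (T : Type) (f : cantor_space -> T) :
  (forall x : cantor_space, exists k, forall y, sdi (mkseq x k) y ->
    f y = f x) ->
  locally_constant f.
Proof.
move=> fP; apply/locally_constantP.
pose Q m := exists N, forall p, N <= size p ->
  exists g, forall x, f (prepend (m ++ p) x) = g.
apply: (fan (Q := Q)) => [m [M hM] [N hN]|x].
  (* The successor accounts for the first letter of the remaining word, which selects the half. *)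
  exists (maxn M N).+1 => -[//|b p]; rewrite /= ltnS geq_max => /andP[Mp Np].
  by rewrite -cat_rcons; case: b; [exact: hN|exact: hM].
have [k kP] := fP x; exists k, 0 => p _; exists (f x) => y.
by apply: kP; rewrite prepend_cat; exact: mem_sdi.
Qed.

Lemma restr_prop m a : locally_constant (fun x => if `[< sdi m x >] then a x
  else 1).
Proof.
apply: locally_constant_near => x; have [k kP] := locconst_near a x.
exists (k + size m) => y xy; rewrite (kP y);
  last exact: sdi_mkseq_le (leq_addr _ _) xy.
rewrite (_ : `[< sdi m y >] = `[< sdi m x >]) //; apply: asbool_equiv_eq.
have [mp pm] : sdi (mkseq x (k + size m)) x /\ size m <= size (mkseq x (k +
  size m)).
  by split; [exact: mem_sdi_mkseq | rewrite size_mkseq leq_addl].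
by split=> h; [exact: sdi_le pm h xy mp | exact: sdi_le pm h mp xy].
Qed.

Definition restr m a : L := LocConst (restr_prop m a).

Lemma restr_in m a x : sdi m x -> restr m a x = a x.
Proof. by move=> h; rewrite /restr /= asboolT. Qed.

Lemma restr_out m a x : ~ sdi m x -> restr m a x = 1.
Proof. by move=> h; rewrite /restr /= asboolF. Qed.

Lemma restrM m a b : restr m (a * b) = restr m a * restr m b.
Proof.
apply: locconstP => x; have [h|h] := pselect (sdi m x).
  by rewrite -[RHS]/(restr m a x * restr m b x) !restr_in.
by rewrite -[RHS]/(restr m a x * restr m b x) !restr_out // mulg1.
Qed.

Lemma sdi_rcons m (b : bool) x : sdi (rcons m b) x <-> sdi m x /\ x (size m) =
  b.
Proof.
split=> [[y _ <-]|[[y _ <-]]].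
  rewrite -cats1 prepend_cat; split; first exact: mem_sdi.
  by rewrite /prepend ltnn subnn.
rewrite {1}/prepend ltnn subnn => yb; exists (fun n => y (1 + n)) => //.
by rewrite -cats1 prepend_cat -[in RHS](prepend_take 1 y) /mkseq /= yb.
Qed.

Lemma restr_split m a : restr m a = restr (rcons m false) a * restr (rcons m
  true) a.
Proof.
apply: locconstP => x.
rewrite -[RHS]/(restr (rcons m false) a x * restr (rcons m true) a x).
have [h|h] := pselect (sdi m x); last first.
  by rewrite !restr_out ?mulg1 // => /sdi_rcons[].
case e : (x (size m)).
  rewrite (restr_in a h) (restr_in a (x := x) (m := rcons m true));
    last exact/sdi_rcons.
  by rewrite restr_out ?mul1g // => /sdi_rcons[_]; rewrite e.
rewrite (restr_in a h) (restr_in a (x := x) (m := rcons m false));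
  last exact/sdi_rcons.
by rewrite restr_out ?mulg1 // => /sdi_rcons[_]; rewrite e.
Qed.

Lemma restr_nil a : restr [::] a = a.
Proof.
by apply: locconstP => x; apply: restr_in; exists x => //; exact: prepend_nil.
Qed.

Lemma locconst_ind (P : L -> Prop) a : (forall b c, P b -> P c -> P (b * c)) ->
  (forall x : cantor_space, exists k, P (restr (mkseq x k) a)) -> P a.
Proof.
move=> PM Px; rewrite -[a]restr_nil.
by apply: (fan (Q := fun m => P (restr m a))) => // m h0 h1;
  rewrite restr_split; exact: PM.
Qed.

Lemma halves a : a = restr [:: false] a * restr [:: true] a.
Proof. by rewrite -[LHS]restr_nil restr_split. Qed.

Lemma locconst_commute a b : (forall x, a x = 1 \/ b x = 1) -> commute a b.
Proof.
move=> ab; apply: locconstP => x; change (a x * b x = b x * a x).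
by case: (ab x) => ->; rewrite mulg1 mul1g.
Qed.

Lemma const_prop (g : Gam) : locally_constant (fun=> g).
Proof. by apply: locally_constant_near => x; exists 0. Qed.

Definition lconst g : L := LocConst (const_prop g).

End Restriction.

Lemma ex_flip : exists s : thompsonV, forall b y,
  s (prepend [:: b] y) = prepend [:: ~~ b] y.
Proof.
have [|s [s0 s1 _]] := @ex_swap [:: false] [:: true].
  by move=> _ [y _ <-] [z _ /(congr1 (fun t : cantor_space => t 0))].
by exists s => -[].
Qed.

Definition flip : thompsonV := sval (cid ex_flip).

Lemma flipE b y : flip (prepend [:: b] y) = prepend [:: ~~ b] y.
Proof. by rewrite /flip; case: cid. Qed.

Lemma head_sdi b x : sdi [:: b] x <-> x 0 = b.
Proof.
rewrite -[[:: b]]/(rcons [::] b); rewrite sdi_rcons /=; split=> [[]//|xb].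
by split=> //; exists x => //; exact: prepend_nil.
Qed.

Lemma flip_head x : flip x 0 = ~~ x 0.
Proof. by rewrite -{1}(prepend_take 1 x) flipE. Qed.

Lemma flipK : involutive flip.
Proof. by move=> x; rewrite -{1}(prepend_take 1 x) !flipE negbK (prepend_take
  1 x). Qed.

Section Jones.
Variables (Gam : groupType) (alpha : bool -> group_iso Gam Gam).
Local Notation L := (locconst Gam).

Lemma jones_eq1 v (a : L) x : jones alpha v a (v x) = 1 <-> a x = 1.
Proof.
rewrite jonesE; split=> [e|->]; last exact: iso1.
by apply: (can_inj (@iso_funK _ _ (tau alpha v x))); rewrite iso1.
Qed.

(** On maps supported in an sdi the action sees only which word replaces that of the sdi, so [u] may
    be traded for a more convenient element with the same replacement. *)
Lemma jones_agree (u w : thompsonV) m m' (a : L) : adapted u m m' ->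
  adapted w m m' ->
  (forall x, ~ sdi m x -> a x = 1) -> jones alpha u a = jones alpha w a.
Proof.
move=> um wm am; apply: locconstP => x.
have [[z _ <-]|h] := pselect (sdi m' x).
  rewrite -{1}um -wm !jonesE (tauE alpha (mem_sdi m z) um).
  by rewrite (tauE alpha (mem_sdi m z) wm).
have out (t : thompsonV) : adapted t m m' -> jones alpha t a x = 1.
  move=> tm; rewrite -(thompsonVVK t x); apply/jones_eq1; apply: am => -[z _ e].
  by apply: h; rewrite -(thompsonVVK t x) -e tm; exact: mem_sdi.
by rewrite !out.
Qed.

End Jones.

Lemma ad_conjg (G : groupType) (h g : G) : ad h g = g ^ h^-1.
Proof. by rewrite /ad /conjg invgK mulgA. Qed.

Section LocInvariant.
Variables (Gam Gam' : groupType).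
Variables (alpha : bool -> group_iso Gam Gam)
  (alpha' : bool -> group_iso Gam' Gam').

Lemma frac_thoM (g h : fraction alpha) : frac_tho (g * h) = frac_tho g *
  frac_tho h.
Proof. by []. Qed.

Lemma frac_thoV (g : fraction alpha) : frac_tho g^-1 = (frac_tho g)^-1.
Proof. by []. Qed.

Lemma frac_tho_inL (g : fraction alpha) : frac_tho g = 1 ->
  g = inL alpha (frac_loc g).
Proof. by case: g => a v /= ->. Qed.

Variable theta : group_iso (fraction alpha) (fraction alpha').
Let q (a : locconst Gam) : thompsonV := frac_tho (theta (inL alpha a)).

(** For [c] supported in one half, with flip [d], commutators of [c] and of conjugates of [d] by
    locally constant maps have disjoint supports, hence commute. So [q c] and [q d] cannot both be
    nontrivial, yet they are conjugate in V. *)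
Lemma frac_tho_inL_iso (a : locconst Gam) : frac_tho (theta (inL alpha a)) = 1.
Proof.
have qM : {morph q : a b / a * b}.
  by move=> b c; rewrite /q inL_morph iso_morph.
have qN b v : exists c, q c = q b ^ v.
  pose g := iso_inv theta (inV alpha' v).
  have tg : frac_tho (inL alpha b ^ g) = 1.
    by rewrite /conjg !frac_thoM mul1g frac_thoV mulVg.
  exists (frac_loc (inL alpha b ^ g)).
  by rewrite /q -(frac_tho_inL tg) (gmulfJ theta) /= iso_invK.
suff half h b : q (restr [:: h] b) = 1.
  by rewrite -/(q a) (halves a) qM !half mulg1.
set c := restr _ _; apply: contrapT => qc.
pose d := jones alpha flip c.
have qd : q d = q c ^ (frac_tho (theta (inV alpha flip)))^-1.
  by rewrite /q -ad_inV ad_conjg (gmulfJ theta) /= (gmulfV theta).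
have dc x : c x = 1 \/ d x = 1.
  have [hx|hx] := pselect (x 0 = h); last first.
    by left; apply: restr_out => /head_sdi.
  right; rewrite -(flipK x); apply/jones_eq1; apply: restr_out => /head_sdi.
  by rewrite flip_head hx; case: (h).
have qd1 : q d = 1.
  apply: (commuting_normal_image qM qN (a := c)) => // e e' f.
  apply: locconst_commute => x; case: (dc x) => ex; [left|right].
    rewrite -[LHS]/((c x)^-1 * ((e x)^-1 * (c x * e x))).
    by rewrite ex invg1 !mul1g mulVg.
  rewrite -[LHS]/(((d ^ f) x)^-1 * ((e' x)^-1 * ((d ^ f) x * e' x))).
  rewrite -[(d ^ f) x]/((f x)^-1 * (d x * f x)) ex mul1g mulVg.
  by rewrite invg1 !mul1g mulVg.
apply: qc; apply: (@conjg_inj _ (frac_tho (theta (inV alpha flip)))^-1).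
by rewrite -qd qd1 conj1g.
Qed.

End LocInvariant.

(** * Splitting off the central part *)

(** The sdi of [m] and [m'] may overlap, so the move passes through a sibling of a long prefix of
    [x]: it is a product of two swaps, both trivial on the next longer prefix. *)
Lemma ex_mover (x : cantor_space) m m' : ~ sdi m x -> ~ sdi m' x ->
  exists t : thompsonV, adapted t m m' /\
    exists k, forall y, sdi (mkseq x k) y -> t y = y.
Proof.
move=> xm xm'; pose n := size m + size m'; pose q := sibling x n.
have mq y : sdi m y -> ~ sdi q y.
  by move=> my /siblingP[xy _];
    apply: (sdi_separate_word xm (leq_addr _ _) my xy).
have m'q y : sdi m' y -> ~ sdi q y.
  by move=> my /siblingP[xy _];
    apply: (sdi_separate_word xm' (leq_addl _ _) my xy).
have [s [sm _ s0]] := ex_swap mq; have [t [_ tq t0]] := ex_swap m'q.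
exists (t * s); split=> [y|]; first by rewrite thompsonVM sm tq.
exists n.+1 => y xy.
have yq : ~ sdi q y by move=> /siblingP[].
have ym : ~ sdi m y.
  by move=> my; apply: (sdi_separate_word xm (leqW (leq_addr _ _)) my xy).
have ym' : ~ sdi m' y.
  by move=> my; apply: (sdi_separate_word xm' (leqW (leq_addl _ _)) my xy).
by rewrite thompsonVM s0 // t0.
Qed.

Section Spatialise.
Variables (Gam Gam' : groupType).
Variables (alpha : bool -> group_iso Gam Gam)
  (alpha' : bool -> group_iso Gam' Gam').
Local Notation L := (locconst Gam).
Local Notation L' := (locconst Gam').
Variables (kap : group_iso L L') (psi : group_iso thompsonV thompsonV).
Variables (phi : homeo) (c : thompsonV -> L').
Hypothesis phiE : forall (v : thompsonV) x, phi (v x) = psi v (phi x).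
Hypothesis kapJ : forall v a,
  kap (jones alpha v a) = ad (c v) (jones alpha' (psi v) (kap a)).

Let K (a : L) x : Gam' := kap a (phi x).
Let T v x : group_iso Gam' Gam' := tau alpha' (psi v) (phi x).

Let KM a b x : K (a * b) x = K a x * K b x.
Proof. by rewrite /K iso_morph. Qed.

Let KV a x : K a^-1 x = (K a x)^-1.
Proof. by rewrite /K (gmulfV kap). Qed.

Let K1 x : K 1 x = 1.
Proof. by rewrite /K iso1. Qed.

Let K_jones v a x : K (jones alpha v a) (v x) = ad (c v (phi (v x))) (T v x (K
  a x)).
Proof.
rewrite /K kapJ -[LHS]/(ad (c v (phi (v x))) (jones alpha' (psi v) (kap a)
  (phi (v x)))).
by rewrite {2}phiE jonesE.
Qed.

Let T_mul (v w : thompsonV) x g : T (v * w) x g = T v (w x) (T w x g).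
Proof. by rewrite /T iso_morph tau_mul phiE. Qed.

(** By continuity of the inverse of [phi], [psi v] is trivial near [phi x], so some prefix of
    [phi x] is adapted with itself as image. *)
Let T_id (v : thompsonV) (x : cantor_space) k g : (forall y,
  sdi (mkseq x k) y -> v y = y) -> T v x g = g.
Proof.
move=> vx; have := iffLR (cantor_continuousP _) (@homeo_inv_cts phi) (phi x) k.
rewrite homeo_funK => -[l lP].
have pid : adapted (psi v) (mkseq (phi x) l) (mkseq (phi x) l).
  move=> y; have /lP/vx e := mem_sdi (mkseq (phi x) l) y.
  by rewrite -{1}(homeo_invK phi (prepend _ y)) -phiE e homeo_invK.
by rewrite /T (tauE _ (mem_sdi_mkseq _ _) pid) /= iso_funK.
Qed.

Let K_commute (a b : L) x : (forall y, a y = 1 \/ b y = 1) ->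
  commute (K a x) (K b x).
Proof. by move=> ab; rewrite /commute -!KM locconst_commute. Qed.

Let K_surj x g : exists a, K a x = g.
Proof. by exists (iso_inv kap (lconst g)); rewrite /K iso_invK. Qed.

(* The values K d x, for d supported in m, form a normal subgroup of Gam'. A
   move of d away from m which is trivial near x conjugates K d x, so this
   subgroup commutes with itself as well as with the values of the maps
   supported off m. *)
Let K_center_word m (a : L) x : ~ sdi m x -> (forall y, ~ sdi m y -> a y = 1) ->
  center (K a x).
Proof.
move=> xm am; pose q := sibling x (size m).
have mq y : sdi m y -> ~ sdi q y.
  by move=> my /siblingP[xy _]; apply: (sdi_separate_word xm (leqnn _) my xy).
have xq : ~ sdi q x by move=> /siblingP[_]; apply; exact: mem_sdi_mkseq.
have [s [smq [k sk]]] := ex_mover xm xq.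
have sx : s x = x by apply: sk; exact: mem_sdi_mkseq.
have comm (d : L) : (forall y, ~ sdi m y -> d y = 1) -> commute (K a x) (K d x).
  (* The move by [s] introduces conjugation by [c s (phi x)], which is written as [K e x]. The
     factor of [e] off [m] commutes with [K (d ^ em) x], and conjugating [d] by [em] in advance
     cancels the factor in [m]. *)
  move=> dm; have [e eC] := K_surj x (c s (phi x)).
  pose em := restr m e; pose e' := em^-1 * e.
  have e'1 y : sdi m y -> e' y = 1.
    by move=> my; rewrite -[LHS]/((em y)^-1 * e y) restr_in // mulVg.
  have em1 y : ~ sdi m y -> (d ^ em) y = 1.
    by move=> my; rewrite -[LHS]/((em y)^-1 * (d y * em y)) dm // mul1g mulVg.
  have : commute (K a x) (K (jones alpha s (d ^ em)) x).
    apply: K_commute => y; have [my|my] := pselect (sdi m y); last by left;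
      exact: am.
    right; rewrite -(thompsonVVK s y); apply/jones_eq1; apply: em1 => -[z _ ez].
    by apply: (mq y my); rewrite -(thompsonVVK s y) -ez smq; exact: mem_sdi.
  rewrite -{2}sx K_jones sx (T_id _ sk) -eC.
  have -> : K e x = K em x * K e' x by rewrite -KM /e' mulVKg.
  have e'd : commute (K e' x) (K (d ^ em) x).
    by apply: K_commute => y; have [my|my] := pselect (sdi m y); [left;
      exact: e'1|right; exact: em1].
  rewrite /ad -(mulgA (K em x)) e'd invgM !mulgA mulgK -KV -!KM.
  by rewrite /conjg !mulgA mulgV mul1g mulgK.
move=> g; have [e <-] := K_surj x g.
have -> : e = restr m e * ((restr m e)^-1 * e) by rewrite mulVKg.
rewrite KM; apply: commuteM.
  by apply: comm => y; exact: restr_out.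
apply: K_commute => y; have [my|my] := pselect (sdi m y); last by left;
  exact: am.
by right; rewrite -[LHS]/((restr m e y)^-1 * e y) restr_in // mulVg.
Qed.

Let center1 (G : groupType) : center (1 : G).
Proof. by move=> g; exact/commute_sym/commute1. Qed.

Let centerM (G : groupType) (g h : G) : center g -> center h -> center (g * h).
Proof. by move=> gc hc k; apply/commute_sym/commuteM; exact/commute_sym. Qed.

(** By compactness, [a] is a product of restrictions that are either trivial or supported in an sdi
    missing [x]. *)
Let K_center (a : L) x : a x = 1 -> center (K a x).
Proof.
move=> ax; apply: (@locconst_ind _ (fun b => center (K b x))) => [b b' ?|z].
  by rewrite KM; exact: centerM.
have [az|az] := pselect (a z = 1).
  have [k kP] := locconst_near a z; exists k; rewrite (_ : restr _ _ = 1);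
    first by rewrite K1; exact: center1.
  apply: locconstP => y; have [zy|zy] := pselect (sdi (mkseq z k) y).
    by rewrite restr_in // kP // az.
  by rewrite restr_out.
have /sdi_separate[k /(_ k (leqnn k)) kx] : z <> x by move=> e; apply: az;
  rewrite e.
by exists k; apply: (K_center_word kx) => y; exact: restr_out.
Qed.

Let K_jones_center (w : thompsonV) (a : L) x : a x = 1 ->
  K (jones alpha w a) (w x) = T w x (K a x).
Proof.
move=> ax; have cT : center (T w x (K a x)).
  move=> g; rewrite -(iso_invK (T w x) g); apply: (gmulf_commute (T w x)).
  exact: K_center.
by rewrite K_jones /ad -cT mulgK.
Qed.

(** Cut [a] into pieces whose sdi, and the image of that sdi under [u], both miss [x]. On each piece
    [u] may be traded for a mover trivial near [x], whose transport map at [x] is the identity. *)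
Let K_move (a : L) (u : thompsonV) x : a x = 1 -> jones alpha u a x = 1 ->
  K (jones alpha u a) x = K a x.
Proof.
move=> ax uax.
apply: (@locconst_ind _ (fun b => K (jones alpha u b) x = K b x)) => [b b' e
  e'|z].
  by rewrite jones_morph !KM e e'.
have [az|az] := pselect (a z = 1).
  have [k kP] := locconst_near a z; exists k.
  rewrite (_ : restr _ _ = 1) ?jones_one ?K1 //.
  apply: locconstP => y; have [zy|zy] := pselect (sdi (mkseq z k) y).
    by rewrite restr_in // kP // az.
  by rewrite restr_out.
have /sdi_separate[k kP] : z <> x by move=> e; apply: az; rewrite e.
have /sdi_separate[l /(_ l (leqnn l)) lP] : u z <> x.
  by move=> e; apply: az; apply/(jones_eq1 alpha u); rewrite e.
have [N /(_ (mkseq z (N + k)))[|m' [mm' lm']]] :=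
  thompson_deep l (thompsonV_thompson u).
  by rewrite size_mkseq leq_addr.
exists (N + k); have {}kP := kP _ (leq_addl N k).
have xm' : ~ sdi m' x.
  move=> m'x; apply: lP; apply: (sdi_le (q := m') (x := u z)) => //.
  - by rewrite size_mkseq.
  - exact: mem_sdi_mkseq.
  - by rewrite -(prepend_take (N + k) z) mm'; exact: mem_sdi.
have [t [tm [j tj]]] := ex_mover kP xm'.
rewrite (jones_agree alpha mm' tm); last by move=> y; exact: restr_out.
have tx : t x = x by apply: tj; exact: mem_sdi_mkseq.
rewrite -{1}tx K_jones_center ?(T_id _ tj) //; exact: restr_out.
Qed.

Let K_transport (a : L) (w : thompsonV) x : a x = 1 -> a (w x) = 1 ->
  K a (w x) = T w x (K a x).
Proof.
move=> ax awx; rewrite -K_jones_center //; apply/esym/K_move => //.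
exact/jones_eq1.
Qed.

(* A replacement for a, equal to 1 at the points x with x 0 = h, which should
   have the same central part as a. *)
Let sig h (a : L) : L := restr [:: ~~ h] a * jones alpha flip (restr [:: h] a).

Let sig_restr h (a : L) (x : cantor_space) : x 0 = h -> restr [:: ~~ h] a x = 1.
Proof. by move=> xh; apply: restr_out => /head_sdi; rewrite xh; case: (h). Qed.

Let sig_jones h (a : L) (x : cantor_space) : x 0 = h ->
  jones alpha flip (restr [:: h] a) x = 1.
Proof.
move=> xh; rewrite -(flipK x); apply/jones_eq1; apply: restr_out => /head_sdi.
by rewrite flip_head xh; case: (h).
Qed.

Let sig_eq1 h (a : L) (x : cantor_space) : x 0 = h -> sig h a x = 1.
Proof.
move=> xh; rewrite -[LHS]/(restr [:: ~~ h] a x * jones alpha flip (restr [::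
  h] a) x).
by rewrite sig_restr // sig_jones // mulg1.
Qed.

Let zval a (x : cantor_space) : Gam' := K (sig (x 0) a) x.

Let zval_center a x : center (zval a x).
Proof. by apply: K_center; exact: sig_eq1. Qed.

Let zval_mul a b x : zval a x * zval b x = zval (a * b) x.
Proof.
rewrite /zval /sig !KM !restrM jones_morph !KM !mulgA; congr (_ * _).
by rewrite -!mulgA; congr (_ * _); apply: K_center; exact: sig_jones.
Qed.

(** When [a x = 1], the flip in [sig] can be undone without changing the value at [x], and the two
    halves multiply back to [a]. *)
Let zval_eq (a : L) x : a x = 1 -> zval a x = K a x.
Proof.
move=> ax; rewrite /zval /sig KM K_move ?sig_jones //.
  rewrite -KM; congr (K _ x); rewrite [RHS]halves; case: (x 0) => //=.
  by apply: locconst_commute => y; case yt : (y 0); [right|left];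
    apply: restr_out => /head_sdi; rewrite yt.
by rewrite restr_in //; exact/head_sdi.
Qed.

Let zval_inv a (w : thompsonV) x : zval a (w x) = T w x (zval a x).
Proof.
have [e|/eqP e] := eqVneq (w x 0) (x 0).
  by rewrite /zval e K_transport // sig_eq1.
have {}e : w x 0 = ~~ x 0 by move: e; case: (w x 0); case: (x 0).
pose y := flip (w x); have ey : w x = flip y by rewrite flipK.
have yh : y 0 = x 0 by rewrite /y flip_head e negbK.
(* Flipping exchanges the two replacements up to the order of their factors, one of which is central
   at this point. *)
have -> : zval a (w x) = K (jones alpha flip (sig (x 0) a)) (w x).
  rewrite /zval e /sig negbK jones_morph !KM -jonesM.
  rewrite (_ : flip * flip = 1) ?jones1; last by apply: thompsonV_ext => z;
    exact: flipK.
  apply: K_center; rewrite restr_out // => /head_sdi; rewrite e; by case: (x 0).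
rewrite ey K_jones_center ?sig_eq1 //.
have -> : w = flip * (flip * w) by apply: thompsonV_ext => z;
  rewrite !thompsonVM flipK.
rewrite [in RHS]T_mul thompsonVM -/y; congr (T flip y _).
rewrite /zval -[y]/((flip * w) x) K_transport // sig_eq1 //.
Qed.

(** The first letter of the preimage under [phi] is locally constant, so near [y] a single
    replacement computes [zval]. *)
Let zloc_prop a : locally_constant (fun y : cantor_space => zval a (homeo_inv
  phi y)).
Proof.
apply: locally_constant_near => y.
have [k kP] := iffLR (cantor_continuousP _) (@homeo_inv_cts phi) y 1%N.
set h := homeo_inv phi y 0; have [l lP] := locconst_near (kap (sig h a)) y.
exists (k + l) => z yz.
have zh : homeo_inv phi z 0 = h.
  have /sdi_mkseq := kP z (sdi_mkseq_le (leq_addr _ _) yz).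
  by move=> /(congr1 (fun s => nth false s 0)).
rewrite /zval zh -/h /K !homeo_invK lP //;
  exact: sdi_mkseq_le (leq_addl _ _) yz.
Qed.

Definition zloc a : L' := LocConst (zloc_prop a).

Let zlocE a x : zloc a (phi x) = zval a x.
Proof. by rewrite -[LHS]/(zval a (homeo_inv phi (phi x))) homeo_funK. Qed.

Lemma zlocM : {morph zloc : a b / a * b}.
Proof. by move=> a b; apply: locconstP => y; apply/esym; exact: zval_mul. Qed.

Lemma zloc_commute a b : commute (zloc a) b.
Proof. by apply: locconstP => y; exact: zval_center. Qed.

Lemma jones_zloc v a : jones alpha' v (zloc a) = zloc a.
Proof.
apply: locconstP => y; rewrite -(iso_invK psi v); set w := iso_inv psi v.
rewrite -(thompsonVVK (psi w) y); set x := _ y.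
rewrite jonesE -(homeo_invK phi x) -phiE !zlocE; exact/esym/zval_inv.
Qed.

Lemma zloc_central a : center (inL alpha' (zloc a)).
Proof.
move=> g; rewrite (frac_decomp g); apply: commuteM.
  by rewrite /commute -!inL_morph zloc_commute.
by rewrite /commute -{1}(jones_zloc (frac_tho g)) -ad_inV /ad mulgVK.
Qed.

(* Both sides are V-invariant, so it suffices to compare them at one point of
   each orbit where a is trivial. *)
Lemma zloc_jones v a : zloc (jones alpha v a) = zloc a.
Proof.
suff half h b x : zval (jones alpha v (restr [:: h] b)) x = zval (restr [:: h]
  b) x.
  apply: locconstP => y; change (zval (jones alpha v a) (homeo_inv phi y) =
    zval a (homeo_inv phi y)).
  by rewrite (halves a) jones_morph -!zval_mul !half.
set b' := restr _ _.
have main y : b' (v^-1 y) = 1 -> zval (jones alpha v b') y = zval b' y.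
  move: (v^-1 y) (thompsonVVK v y) => z <- bz.
  rewrite zval_eq; last exact/jones_eq1.
  by rewrite K_jones_center // -zval_eq // zval_inv.
have b'1 z : z 0 = ~~ h -> b' z = 1.
  by move=> zh; apply: restr_out => /head_sdi; rewrite zh; case: (h).
have [xh|xh] := eqVneq ((v^-1 x) 0) (~~ h); first by apply: main; exact: b'1.
(* [w] carries [x] to a point where [main] applies, and both sides change by the same map
   [T w x]. *)
pose w := v * flip * v^-1.
have wx : v^-1 (w x) = flip (v^-1 x) by rewrite /w !thompsonVM thompsonVK.
apply: (can_inj (@iso_funK _ _ (T w x))); rewrite -!zval_inv; apply: main.
apply: b'1; rewrite wx flip_head; by move: xh; case: (_ 0); case: (h).
Qed.

Definition spatial_part a : L' := (zloc a)^-1 * kap a.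

Lemma spatial_partM : {morph spatial_part : a b / a * b}.
Proof.
move=> a b; rewrite /spatial_part zlocM iso_morph invgM.
have zC d e : commute (zloc d)^-1 e.
  exact/commute_sym/commuteV/commute_sym/zloc_commute.
by rewrite (zC b (zloc a)^-1) -!mulgA; congr (_ * _);
  rewrite mulgA (zC b (kap a)) -mulgA.
Qed.

Lemma kap_split a : kap a = zloc a * spatial_part a.
Proof. by rewrite mulVKg. Qed.

Lemma spatial_part_eq1 (a : L) x : a x = 1 -> spatial_part a (phi x) = 1.
Proof.
move=> ax; rewrite -[LHS]/((zloc a (phi x))^-1 * kap a (phi x)) zlocE zval_eq
  //.
exact: mulVg.
Qed.

Lemma spatial_part_jones v a :
  spatial_part (jones alpha v a) = ad (c v) (jones alpha' (psi v)
    (spatial_part a)).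
Proof.
rewrite /spatial_part zloc_jones kapJ jones_morph /ad.
have -> : jones alpha' (psi v) (zloc a)^-1 = (zloc a)^-1.
  apply: (@mulgI _ (zloc a)); rewrite mulgV.
  by rewrite -{1}(jones_zloc (psi v) a) -jones_morph mulgV jones_one.
have zC e : commute (zloc a)^-1 e.
  exact/commute_sym/commuteV/commute_sym/zloc_commute.
by rewrite !mulgA -zC.
Qed.

End Spatialise.

(** * The spatial parts of an isomorphism and of its inverse are mutually inverse *)

Section RoundTrip.
Variables (Gam Gam' : groupType).
Variables (alpha : bool -> group_iso Gam Gam)
  (alpha' : bool -> group_iso Gam' Gam').
Local Notation L := (locconst Gam).
Local Notation L' := (locconst Gam').
Variables (kap : group_iso L L') (kap' : group_iso L' L).
Variables (psi psi' : group_iso thompsonV thompsonV) (phi phi' : homeo).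
Variables (c : thompsonV -> L') (c' : thompsonV -> L).
Hypothesis phiE : forall (v : thompsonV) x, phi (v x) = psi v (phi x).
Hypothesis phi'E : forall (v : thompsonV) x, phi' (v x) = psi' v (phi' x).
Hypothesis kapJ : forall v a,
  kap (jones alpha v a) = ad (c v) (jones alpha' (psi v) (kap a)).
Hypothesis kap'J : forall v a,
  kap' (jones alpha' v a) = ad (c' v) (jones alpha (psi' v) (kap' a)).
Hypothesis kapK : cancel kap kap'.
Hypothesis phiK : cancel phi phi'.

Let k0 := spatial_part alpha kap phi.
Let k0' := spatial_part alpha' kap' phi'.

(** Every [v] is some [psi' w]; invariance of [zloc] under [w] passes through [kap'], where
    centrality removes the conjugation by [c' w]. *)
Let kap'_zloc a v : jones alpha v (kap' (zloc alpha kap phi a)) = kap' (zloc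
  alpha kap phi a).
Proof.
set z := zloc _ _ _ _; pose w := iso_inv psi' v.
have zC b : commute (kap' z) b.
  rewrite -(iso_invK kap' b); apply: (gmulf_commute kap').
  exact: (zloc_commute phiE kapJ).
have := kap'J w z; rewrite (jones_zloc phiE kapJ) iso_invK => e.
by apply: (@mulgI _ (c' w)); rewrite -[RHS]zC {2}e /ad mulgVK.
Qed.

(** For [b'] supported in one half, the discrepancy [D] is invariant under V, and trivial on the
    other half because spatial parts are trivial wherever their arguments are. Invariance under
    [flip] then makes [D] trivial everywhere. *)
Lemma spatial_partK a : k0' (k0 a) = a.
Proof.
suff half h b : k0' (k0 (restr [:: h] b)) = restr [:: h] b.
  rewrite (halves a) /k0 (spatial_partM phiE kapJ) /k0' (spatial_partM phi'E
    kap'J).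
  by congr (_ * _); exact: half.
set b' := restr _ _.
pose D := kap' (zloc alpha kap phi b') * zloc alpha' kap' phi' (k0 b').
have bD : b' = D * k0' (k0 b').
  by rewrite -[LHS]kapK (kap_split alpha kap phi) iso_morph (kap_split alpha'
    kap' phi' (spatial_part _ _ _ _)) mulgA.
have DJ v : jones alpha v D = D.
  by rewrite jones_morph kap'_zloc (jones_zloc phi'E kap'J).
have D1 x : x 0 = ~~ h -> D x = 1.
  move=> xh; have bx : b' x = 1.
    by apply: restr_out => /head_sdi; rewrite xh; case: (h).
  have k1 := spatial_part_eq1 phiE kapJ bx.
  have k2 := spatial_part_eq1 phi'E kap'J k1; rewrite phiK in k2.
  move: bx; rewrite {1}bD -[LHS]/(D x * k0' (k0 b') x).
  by rewrite /k0' /k0 k2 mulg1.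
suff D1' : D = 1 by rewrite [RHS]bD D1' mul1g.
apply: locconstP => x; have [xh|xh] := eqVneq (x 0) (~~ h); first exact: D1.
rewrite -(DJ flip) -(flipK x); apply/jones_eq1; apply: D1.
by rewrite flip_head; move: xh; case: (x 0); case: (h).
Qed.

End RoundTrip.

(** * Components of [theta] on locally constant maps and on V *)

Section FractionIso.
Variables (Gam Gam' : groupType).
Variables (alpha : bool -> group_iso Gam Gam)
  (alpha' : bool -> group_iso Gam' Gam').
Variable theta : group_iso (fraction alpha) (fraction alpha').

Definition loc_part (a : locconst Gam) := frac_loc (theta (inL alpha a)).
Definition tho_part (v : thompsonV) := frac_tho (theta (inV alpha v)).
Definition cocycle_part (v : thompsonV) := frac_loc (theta (inV alpha v)).

Lemma theta_inL a : theta (inL alpha a) = inL alpha' (loc_part a).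
Proof. by apply: frac_tho_inL; exact: frac_tho_inL_iso. Qed.

Lemma theta_inV v :
  theta (inV alpha v) = inL alpha' (cocycle_part v) * inV alpha' (tho_part v).
Proof. exact: frac_decomp. Qed.

Lemma loc_partM : {morph loc_part : a b / a * b}.
Proof.
move=> a b; have := theta_inL (a * b).
rewrite inL_morph iso_morph !theta_inL -inL_morph.
by move=> /(congr1 (@frac_loc _ _)).
Qed.

Lemma tho_partM : {morph tho_part : v w / v * w}.
Proof. by move=> v w; rewrite /tho_part inV_morph iso_morph. Qed.

Lemma cocycle_partM v w :
  cocycle_part (v * w) = cocycle_part v * jones alpha' (tho_part v)
    (cocycle_part w).
Proof. by rewrite /cocycle_part inV_morph iso_morph. Qed.

Lemma loc_part_jones v a : loc_part (jones alpha v a)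
  = ad (cocycle_part v) (jones alpha' (tho_part v) (loc_part a)).
Proof.
have adL b d : ad (inL alpha' b) (inL alpha' d) = inL alpha' (ad b d).
  by apply: (@mulIg _ (inL alpha' b)); rewrite /ad mulgVK -!inL_morph mulgVK.
have := theta_inL (jones alpha v a).
rewrite -ad_inV ad_conjg (gmulfJ theta) /= (gmulfV theta) /= theta_inL
  theta_inV.
rewrite invgM conjgM -[_ ^ (inV _ _)^-1]ad_conjg ad_inV -ad_conjg adL.
by move=> /(congr1 (@frac_loc _ _)).
Qed.

End FractionIso.

Section FractionIsoInverse.
Variables (Gam Gam' : groupType).
Variables (alpha : bool -> group_iso Gam Gam)
  (alpha' : bool -> group_iso Gam' Gam').
Variable theta : group_iso (fraction alpha) (fraction alpha').

Lemma loc_partK : cancel (loc_part theta) (loc_part (iso_sym theta)).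
Proof.
by move=> a; rewrite /loc_part -theta_inL /= iso_funK.
Qed.

Lemma tho_partK : cancel (tho_part theta) (tho_part (iso_sym theta)).
Proof.
move=> v; have /(congr1 (iso_inv theta)) := theta_inV theta v.
rewrite iso_funK (iso_sym_morph theta).
rewrite -[iso_inv theta (inL _ _)]/(iso_sym theta (inL _ _)) theta_inL.
by move=> /(congr1 (@frac_tho _ _)) /=; rewrite mul1g.
Qed.

End FractionIsoInverse.

Section FractionIsoParts.
Variables (Gam Gam' : groupType).
Variables (alpha : bool -> group_iso Gam Gam)
  (alpha' : bool -> group_iso Gam' Gam').
Variable theta : group_iso (fraction alpha) (fraction alpha').

(** The maps underlying [iso_sym (iso_sym theta)] and [theta] are convertible, so one lemma gives
    both cancellations. *)
Definition loc_iso : group_iso (locconst Gam) (locconst Gam') :=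
  GroupIso (loc_partM theta) (loc_partK theta)
    (loc_partK (iso_sym theta) : cancel _ (loc_part theta)).

Definition tho_iso : group_iso thompsonV thompsonV :=
  GroupIso (tho_partM theta) (tho_partK theta)
    (tho_partK (iso_sym theta) : cancel _ (tho_part theta)).

End FractionIsoParts.

(** * Fibre isomorphisms of a spatial isomorphism *)

Section Fibres.
Variables (Gam Gam' : groupType) (f : group_iso (locconst Gam) (locconst Gam')).
Variables (phi : cantor_space -> cantor_space) (x : cantor_space).
Hypothesis f1 : forall a : locconst Gam, a x = 1 -> f a (phi x) = 1.
Hypothesis f1' : forall b : locconst Gam', b (phi x) = 1 -> iso_inv f b x = 1.

Lemma fibre_eq (a b : locconst Gam) : a x = b x -> f a (phi x) = f b (phi x).
Proof.
move=> ab; apply: divg1_eq.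
rewrite -[LHS]/((f a / f b) (phi x)) -(gmulfF f); apply: f1.
by rewrite -[LHS]/(a x / b x) ab mulgV.
Qed.

Lemma fibre_inv_eq (a b : locconst Gam') : a (phi x) = b (phi x) ->
  iso_inv f a x = iso_inv f b x.
Proof.
move=> ab; apply: divg1_eq.
rewrite -[LHS]/((iso_sym f a / iso_sym f b) x) -(gmulfF (iso_sym f));
  apply: f1'.
by rewrite -[LHS]/(a (phi x) / b (phi x)) ab mulgV.
Qed.

Lemma fibre_morph : {morph (fun g => f (lconst g) (phi x)) : g h / g * h}.
Proof.
move=> g h; rewrite -[RHS]/((f (lconst g) * f (lconst h)) (phi x)) -iso_morph.
exact: fibre_eq.
Qed.

Lemma fibreK : cancel (fun g => f (lconst g) (phi x)) (fun h => iso_inv f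
  (lconst h) x).
Proof. by move=> g; rewrite (@fibre_inv_eq _ (f (lconst g))) // iso_funK. Qed.

Lemma fibre_invK : cancel (fun h => iso_inv f (lconst h) x) (fun g => f
  (lconst g) (phi x)).
Proof. by move=> h; rewrite (@fibre_eq _ (iso_inv f (lconst h))) // iso_invK.
  Qed.

(** The value at [phi x] depends only on the value at [x], so constant maps can represent the
    elements of the fibre. *)
Definition fibre : group_iso Gam Gam' := GroupIso fibre_morph fibreK fibre_invK.

Lemma fibreE (a : locconst Gam) : f a (phi x) = fibre (a x).
Proof. exact: fibre_eq. Qed.

End Fibres.

(** * Assembly of the decomposition of [theta] *)

Theorem theorem2p8 (Gam Gam' : groupType)
  (alpha : bool -> group_iso Gam Gam) (alpha' : bool -> group_iso Gam' Gam')
  (theta : group_iso (fraction alpha) (fraction alpha')) :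
  exists (zeta : {multiplicative fraction alpha -> fraction alpha'})
         (phi : normV)
         (kappa0 : group_iso (locconst Gam) (locconst Gam'))
         (c : thompsonV -> locconst Gam'),
    (forall g, center (zeta g)) /\
    is_cocycle alpha' phi c /\
    (forall (a : locconst Gam) (v : thompsonV),
        theta (inL alpha a * inV alpha v)
        = zeta (inL alpha a) * inL alpha' (kappa0 a) * inL alpha' (c v)
          * inV alpha' (adV phi v)) /\
    (forall a : locconst Gam, supp (kappa0 a) = [set phi x | x in supp a]) /\
    (exists kappa0_ : cantor_space -> group_iso Gam Gam',
        (forall (a : locconst Gam) (x : cantor_space),
            kappa0 a (phi x) = kappa0_ x (a x)) /\
        (forall (x : cantor_space) (v : thompsonV),
            kappa0_ (v x) \o tau alpha v x
            =1 ad (c v (phi (v x))) \o tau alpha' (adV phi v) (phi x)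
               \o kappa0_ x)).
Proof.
pose theta' := iso_sym theta.
have [phi psiE] := thompsonV_automorphism (tho_iso theta).
have phiE (v : thompsonV) x : phi (v x) = tho_iso theta v (phi x).
  by rewrite psiE -[RHS]/(phi (v (homeo_inv phi (phi x)))) homeo_funK.
pose phi' := homeo_sym phi.
have phi'E (v : thompsonV) x : phi' (v x) = tho_iso theta' v (phi' x).
  apply: (can_inj (@homeo_funK phi));
    rewrite phiE -[tho_iso theta' v]/(iso_inv (tho_iso theta) v).
  by rewrite iso_invK -[phi (phi' x)]/(phi (homeo_inv phi x)) -[phi (phi' (v
    x))]/(phi (homeo_inv phi (v x))) !homeo_invK.
pose kap := loc_iso theta; pose kap' := loc_iso theta'.
have kapJ := loc_part_jones theta : forall v a, kap (jones alpha v a) =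
  ad (cocycle_part theta v) (jones alpha' (tho_iso theta v) (kap a)).
have kap'J := loc_part_jones theta' : forall v a, kap' (jones alpha' v a) =
  ad (cocycle_part theta' v) (jones alpha (tho_iso theta' v) (kap' a)).
pose k0 : group_iso (locconst Gam) (locconst Gam') :=
  GroupIso (spatial_partM phiE kapJ)
    (spatial_partK phiE phi'E kapJ kap'J (@iso_funK _ _ kap) (@homeo_funK phi))
    (spatial_partK phi'E phiE kap'J kapJ (@iso_invK _ _ kap) (@homeo_invK phi)).
have k01 x (a : locconst Gam) : a x = 1 ->
  k0 a (phi x) = 1 := @spatial_part_eq1 _ _ _ _ _ _ _ _ phiE kapJ a x.
have k01' x (b : locconst Gam') : b (phi x) = 1 -> iso_inv k0 b x = 1.
  by move=> /(spatial_part_eq1 phi'E kap'J); rewrite [phi' _](homeo_funK phi).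
(* [z] forgets the V-component of [g]; it is multiplicative because [zloc] is unchanged by the Jones
   action on its argument. *)
pose z (g : fraction alpha) := inL alpha' (zloc alpha kap phi (frac_loc g)).
have zM : {morph z : g h / g * h}.
  move=> g h; rewrite /z -inL_morph; congr (inL _ _).
  by rewrite [LHS](zlocM phiE kapJ) (zloc_jones phiE kapJ).
pose zeta : {multiplicative fraction alpha -> fraction alpha'} :=
  HB.pack z (isMultiplicative.Build _ _ z zM).
exists zeta, phi, k0, (cocycle_part theta).
split; first by move=> g; exact: (zloc_central phiE kapJ).
split; first by move=> v w; rewrite cocycle_partM -psiE.
split.
  move=> a v; rewrite iso_morph theta_inL theta_inV -psiE mulgA;
    congr (_ * _ * _).
  rewrite -[zeta _]/(inL alpha' (zloc alpha kap phi a)) -inL_morph;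
    congr (inL _ _).
  exact: (kap_split alpha kap phi a).
split.
  move=> a; apply/seteqP; split=> [y ya|_ [x xa <-] e].
    exists (homeo_inv phi y); last exact: homeo_invK.
    by move=> ay; apply: ya; rewrite -(homeo_invK phi y); exact: k01.
  by apply: xa; rewrite -(iso_funK k0 a); exact: k01'.
exists (fun x => fibre (@k01 x) (@k01' x)); split=> [a x|x v g].
  exact: fibreE.
(* The relation is the equivariance of [k0], read on the constant map with value [g]. *)
pose a := lconst g; have ja : jones alpha v a (v x) = tau alpha v x g by
  exact: jonesE.
rewrite -[LHS]/(fibre (@k01 (v x)) (@k01' (v x)) (tau alpha v x g)) -ja -fibreE.
rewrite -[LHS]/(spatial_part alpha kap phi (jones alpha v a) (phi (v x))).
rewrite (spatial_part_jones phiE kapJ) -psiE.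
rewrite -[LHS]/(ad (cocycle_part theta v (phi (v x)))
  (jones alpha' (tho_iso theta v) (k0 a) (phi (v x)))).
by rewrite {2}phiE jonesE.
Qed.
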